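(* For every point $\mathbf y$ in the imaging window $\mathcal W$ one has $$\mathcal I_{KM}[\mathbf p(\boldsymbol\Psi)](\mathbf y;k)=\mathcal I_{KM}[\mathbf U_\parallel\widetilde{\boldsymbol\Pi}\mathbf U_s^*](\mathbf y;k)+o(1)\quad\text{as }k\to\infty,$$ provided the source location $\mathbf x_s$ lies outside of the region $$\mathcal R(\gamma)=\bigcup_{\mathbf x_r\in\mathcal A}\left\{\mathbf z\in\mathbb R^3:\ |\mathbf x_{r,\parallel}-\mathbf z_\parallel|\le \kappa\,\gamma\,|\mathbf x_r-\mathbf z|\right\},\qquad \kappa=\frac{a+b}{\sqrt{(2L-h)^2+(a+b)^2}}.$$ If weak scattering holds, i.e. $\boldsymbol\Pi=\boldsymbol\Pi_1$ (Born approximation), one can take $\gamma=1$. Alternatively, if finitely many scattering events are kept, i.e. $\boldsymbol\Pi=\sum_{j=1}^{J}\boldsymbol\Pi_j$ for some finite $J$, then $\gamma=3$ is sufficient.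
   Context: Geometry: points of $\mathbb R^3$ are written $\mathbf x=(\mathbf x_\parallel,x_3)$. The array $\mathcal A$ is a square of side $a$ in the plane $x_3=0$ centered at the origin (also identified with a subset of $\mathbb R^2$). The imaging window is $\mathcal W=[-b/2,b/2]^2\times[L-h/2,L+h/2]$ with $a,b,h,L>0$ fixed and $h<2L$; it contains all scatterers, which are located at distinct points $\mathbf y_1,\dots,\mathbf y_N$. The source is at $\mathbf x_s\in\mathbb R^3$, and $\mathbf y_0$ is a fixed point near the scatterers. Green functions: for $k>0$, $\mathbf x\ne\mathbf y$, with $\mathbf r=\mathbf x-\mathbf y$, $r=|\mathbf r|$, $$\mathbf G(\mathbf x,\mathbf y;k)=G(\mathbf x,\mathbf y;k)\left[(1+m(kr))\mathbf I-(1+3m(kr))\frac{\mathbf r\mathbf r^\top}{r^2}\right],\quad G(\mathbf x,\mathbf y;k)=\frac{e^{\imath kr}}{4\pi r},\quad m(kr)=\frac{\imath kr-1}{(kr)^2}.$$ Data: each scatterer has a $3\times3$ complex symmetric polarizability tensor $\boldsymbol\alpha(\mathbf y_n)$, independent of frequency. The $j$-th term of the Born series is $$\boldsymbol\Pi_j(\mathbf x_r,\mathbf x_s;k)=\sum \mathbf G(\mathbf x_r,\mathbf y_{n_1};k)\boldsymbol\alpha(\mathbf y_{n_1})\mathbf G(\mathbf y_{n_1},\mathbf y_{n_2};k)\boldsymbol\alpha(\mathbf y_{n_2})\cdots\boldsymbol\alpha(\mathbf y_{n_j})\mathbf G(\mathbf y_{n_j},\mathbf x_s;k),$$ the sum being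 over all $(n_1,\dots,n_j)\in\{1,\dots,N\}^j$ with consecutive indices distinct. In particular $\boldsymbol\Pi_1=\sum_n\mathbf G(\mathbf x_r,\mathbf y_n;k)\boldsymbol\alpha(\mathbf y_n)\mathbf G(\mathbf y_n,\mathbf x_s;k)$ is the Born approximation. Let $\mathbf U_\parallel=[\mathbf e_1,\mathbf e_2]$ and let $\mathbf U_s$ be the real $3\times2$ matrix whose columns form an orthonormal basis of $(\mathbf y_0-\mathbf x_s)^\perp$. Put $\widetilde{\mathbf G}=\mathbf U_\parallel^*\mathbf G(\mathbf x_r,\mathbf x_s;k)\mathbf U_s$ and $\widetilde{\boldsymbol\Pi}=\mathbf U_\parallel^*\boldsymbol\Pi(\mathbf x_r,\mathbf x_s;k)\mathbf U_s$ ($2\times2$ matrices). Let $\widetilde{\mathbf J}_s$ be a known invertible $2\times 2$ Hermitian matrix, independent of frequency (coherency matrix of the source). The coherency matrix data at $\mathbf x_r\in\mathcal A$ is $$\boldsymbol\Psi=\widetilde{\mathbf G}\widetilde{\mathbf J}_s\widetilde{\mathbf G}^*+\widetilde{\boldsymbol\Pi}\widetilde{\mathbf J}_s\widetilde{\mathbf G}^*+\widetilde{\mathbf G}\widetilde{\mathbf J}_s\widetilde{\boldsymbol\Pi}^*+\widetilde{\boldsymbol\Pi}\widetilde{\mathbf J}_s\widetilde{\boldsymbol\Pi}^*,$$ and the preprocessed data is $$\mathbf p(\boldsymbol\Psi)=\mathbf U_\parallel\left[\boldsymbol\Psi-\widetilde{\mathbf G}\widetilde{\mathbf J}_s\widetilde{\mathbf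 G}^*\right]\widetilde{\mathbf G}^{-*}\widetilde{\mathbf J}_s^{-1}\mathbf U_s^*,$$ where $\widetilde{\mathbf G}^{-*}=(\widetilde{\mathbf G}^* )^{-1}$. It is assumed that $\widetilde{\mathbf G}$ is invertible at every point of the array, with condition number bounded independently of $k$ (for large $k$) and of $\mathbf x_r\in\mathcal A$. Kirchhoff imaging function: for a $3\times 3$ matrix field $\mathbf M(\mathbf x_r,\mathbf x_s;k)$ on the array, $$\mathcal I_{KM}[\mathbf M](\mathbf y;k)=\int_{\mathcal A}d\mathbf x_{r,\parallel}\,\overline{\mathbf G(\mathbf x_r,\mathbf y;k)}\,\mathbf M(\mathbf x_r,\mathbf x_s;k)\,\overline{\mathbf G(\mathbf x_s,\mathbf y;k)}.$$
   Formalization: In the Born case (γ=1) it is additionally assumed that neither the image point y nor any scatterer y_n is the mirror image of x_s in the array plane x_3=0; without this the claim can fail when b>(3+2√2)a. *)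

(* Defs.v *)
From HB Require Import structures.
From mathcomp Require Import all_boot all_order all_algebra.
From mathcomp Require Import complex.
From mathcomp Require Import all_classical all_reals all_analysis.

Set Implicit Arguments.
Unset Strict Implicit.
Unset Printing Implicit Defensive.

Import Order.TTheory GRing.Theory Num.Theory.
Import numFieldNormedType.Exports.

Local Open Scope classical_set_scope.
Local Open Scope ring_scope.
Local Open Scope complex_scope.
Local Open Scope sesquilinear_scope.

Section Norms.
Variable R : realType.

(* The library norm on matrices is the maximum norm, hence these. *)
Definition enorm n (x : 'cV[R]_n) : R := Num.sqrt (\sum_i (x i 0) ^+ 2).
Definition hnorm n (v : 'cV[R[i]]_n) : R :=
  Num.sqrt (\sum_i (Normc.normc (v i 0)) ^+ 2).

Definition opnorm m n (A : 'M[R[i]]_(m, n)) : R :=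
  sup [set hnorm (A *m v) | v in [set v : 'cV[R[i]]_n | hnorm v <= 1]].

Definition cond_number n (A : 'M[R[i]]_n) : R := opnorm A * opnorm (invmx A).

End Norms.

Section Geometry.
Variable R : realType.

(* The matrix [e_1, e_2], over any ring. *)
Definition Upar {S : nzRingType} : 'M[S]_(3, 2) := pid_mx 2.

Definition par (x : 'cV[R]_3) : 'cV[R]_2 := Upar^T *m x.
Definition x3 (x : 'cV[R]_3) : R := x ord_max 0.

(* The array as a subset of R^2, and the point (u, 0) of R^3. *)
Definition array (a : R) : set (R * R) :=
  `[- (a / 2), a / 2]%classic `*` `[- (a / 2), a / 2]%classic.
Definition array_point (u : R * R) : 'cV[R]_3 :=
  \col_(i < 3) [:: u.1; u.2; 0]`_i.

Definition window (b h L : R) : set 'cV[R]_3 :=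
  [set y | (forall i, - (b / 2) <= par y i 0 <= b / 2) /\
           L - h / 2 <= x3 y <= L + h / 2].

Definition kappa (a b h L : R) : R :=
  (a + b) / Num.sqrt ((2 * L - h) ^+ 2 + (a + b) ^+ 2).

Definition region (a b h L gamma : R) : set 'cV[R]_3 :=
  \bigcup_(u in array a)
    [set z | enorm (par (array_point u) - par z) <=
             kappa a b h L * gamma * enorm (array_point u - z)].

(* Reflection in the plane of the array: x and mirror x are at the same distance
   from every point of the array, so phases |x_r - x| - |x_r - mirror x| vanish
   identically. *)
Definition mirror (x : 'cV[R]_3) : 'cV[R]_3 :=
  \col_i (if i == ord_max then - x i 0 else x i 0).

(* The columns of U form an orthonormal basis of the orthogonal complement of d:
   the rows of U^T span the left kernel of the column d. *)
Definition orthonormal_basis_perp (d : 'cV[R]_3) (U : 'M[R]_(3, 2)) : Prop :=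
  U^T *m U = 1%:M /\ (U^T == kermx d)%MS.

End Geometry.

Section Green.
Variable R : realType.
Implicit Types (x y : 'cV[R]_3) (k t : R).

Definition cis t : R[i] := cos t +i* sin t.

Definition Green0 x y k : R[i] :=
  cis (k * enorm (x - y)) / (4 * pi * enorm (x - y))%:C.

Definition green_m t : R[i] := ((-1) +i* t) / (t ^+ 2)%:C.

(* 0 when x = y. *)
Definition Green x y k : 'M[R[i]]_3 :=
  let r := x - y in
  let m := green_m (k * enorm r) in
  Green0 x y k *: ((1 + m)%:M -
    ((1 + 3 * m) / (enorm r ^+ 2)%:C) *: map_mx (real_complex R) (r *m r^T)).

End Green.

(* M x_r x_s k *)
Definition mxfield (R : realType) (m n : nat) : Type :=
  'cV[R]_3 -> 'cV[R]_3 -> R -> 'M[R[i]]_(m, n).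

Section Born.
Variables (R : realType) (N : nat).
Variables (ys : 'I_N -> 'cV[R]_3) (alpha : 'I_N -> 'M[R[i]]_3).

(* G(x, y_{n_1}) alpha(y_{n_1}) G(y_{n_1}, y_{n_2}) ... G(y_{n_j}, xs)
   for s = [:: n_1; ...; n_j]. *)
Fixpoint scattering_path (xs : 'cV[R]_3) (k : R) (x : 'cV[R]_3) (s : seq 'I_N) :
    'M[R[i]]_3 :=
  if s is n :: s' then
    Green x (ys n) k *m alpha n *m scattering_path xs k (ys n) s'
  else Green x xs k.

(* sorted (!=) only compares consecutive entries. *)
Definition born_term (j : nat) : mxfield R 3 3 := fun xr xs k =>
  \sum_(s : j.-tuple 'I_N | sorted (fun m n => m != n) s)
    scattering_path xs k xr s.

(* J scattering events at most. *)
Definition born_sum (J : nat) : mxfield R 3 3 := fun xr xs k =>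
  \sum_(1 <= j < J.+1) born_term j xr xs k.

End Born.

Section Data.
Variable R : realType.
Variables (Us : 'M[R]_(3, 2)) (Js : 'M[R[i]]_2).

(* Upar^* M Us *)
Definition tilde (M : mxfield R 3 3) : mxfield R 2 2 := fun xr xs k =>
  Upar ^t* *m M xr xs k *m map_mx (real_complex R) Us.

(* Upar M Us^* *)
Definition untilde (M : mxfield R 2 2) : mxfield R 3 3 := fun xr xs k =>
  Upar *m M xr xs k *m (map_mx (real_complex R) Us) ^t*.

Definition coherency (Pi : mxfield R 3 3) : mxfield R 2 2 := fun xr xs k =>
  let G := tilde (@Green R) xr xs k in
  let P := tilde Pi xr xs k in
  G *m Js *m G ^t* + P *m Js *m G ^t* + G *m Js *m P ^t* + P *m Js *m P ^t*.

Definition preprocess (Psi : mxfield R 2 2) : mxfield R 3 3 :=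
  untilde (fun xr xs k =>
    let G := tilde (@Green R) xr xs k in
    (Psi xr xs k - G *m Js *m G ^t*) *m invmx (G ^t*) *m invmx Js).

(* tilde Green is invertible on the array, with condition number bounded uniformly in
   large k and in the array point. *)
Definition well_conditioned (a : R) (xs : 'cV[R]_3) : Prop :=
  exists C K : R, forall k u, K <= k -> array a u ->
    let G := tilde (@Green R) (array_point u) xs k in
    G \in unitmx /\ cond_number G <= C.

End Data.

Section Imaging.
Variable R : realType.

Definition mxconj m n (A : 'M[R[i]]_(m, n)) : 'M[R[i]]_(m, n) := map_mx Num.conj A.

Definition cintegral (D : set (R * R)) (f : R * R -> R[i]) : R[i] :=
  (\int[(@lebesgue_measure R \x @lebesgue_measure R)%E]_(u in D) complex.Re (f u)) +i*
  (\int[(@lebesgue_measure R \x @lebesgue_measure R)%E]_(u in D) complex.Im (f u)).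

Definition mxintegral m n (D : set (R * R)) (F : R * R -> 'M[R[i]]_(m, n)) :
    'M[R[i]]_(m, n) :=
  \matrix_(i, j) cintegral D (fun u => F u i j).

Definition kirchhoff (a : R) (xs : 'cV[R]_3) (M : mxfield R 3 3)
    (y : 'cV[R]_3) (k : R) : 'M[R[i]]_3 :=
  mxintegral (array a) (fun u =>
    mxconj (Green (array_point u) y k) *m M (array_point u) xs k *m
    mxconj (Green xs y k)).

(* f = g + o(1) as k -> +oo *)
Definition asymp_eq m n (f g : R -> 'M[R[i]]_(m, n)) : Prop :=
  opnorm (f k - g k) @[k --> +oo] --> (0 : R).

End Imaging.

(* Main.v *)
Require Import Defs.
From mathcomp Require Import all_boot all_order all_algebra.
From mathcomp Require Import complex.
From mathcomp Require Import all_classical all_reals all_analysis.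
From mathcomp Require Import measurable_realfun ring lra.
Import Order.TTheory GRing.Theory Num.Theory.
Import numFieldNormedType.Exports.
Local Open Scope classical_set_scope.
Local Open Scope ring_scope.

(* The two error terms are oscillatory integrals over the array. After the phases
   of the Green functions are factored out, the remaining amplitudes are bounded
   and Lipschitz on the array uniformly in [k], and the phases are
   [2 |x - xs| - |x - y_m| - |x - y|] and [|x - xs| + |x - y_n| - |x - y_m| - |x - y|].
   Neither needs to be free of stationary points: it suffices that on almost every
   line of the array the phase has finitely many critical points. This holds because
   the branch point of [|x - xs|] in the complexified line is shared by another
   distance only if the corresponding point is [xs] or its mirror image. Bounded
   condition numbers force [xs] off the plane of the array and bound the
   inverse of the tilde Green matrix, since for 2 x 2 matrices
   [|A_ij|^2 <= cond(A) |det A|]. *)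

(** Multiplied out, the preprocessed data is the wanted term plus [(G + P) J P^* G^{-*} J^{-1}]. The
    inverse of the conjugated direct field carries the phase [+ k |x - xs|], whence the coefficient
    2 of that distance in the first error phase and 1 in the second. Since only [o(1)] is claimed,
    no rate and no information on the order of the critical points is kept: small neighbourhoods of
    them are cut out, the amplitude is frozen on short intervals, and dominated convergence collects
    the lines. Asking no limit of the amplitudes is also what admits multiple scattering, whose
    inner factors keep oscillating in [k]. What the phases demand is that [y] and all scatterers
    differ from [xs] and from its mirror image. For [gamma = 3] this follows from the position of
    [xs], because the window and its reflection lie inside that region. For [gamma = 1] a window
    that is wide compared with the array can have corners outside the region, hence the explicit
    mirror hypotheses there; the coincidence [y = xs] is settled by [Green] being 0 on the
    diagonal. *)

Module Aux.
Set Implicit Arguments.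
Unset Strict Implicit.
Unset Printing Implicit Defensive.
Local Open Scope complex_scope.
Local Open Scope sesquilinear_scope.

(** * Oscillatory integrals on a segment *)

Section Oscillation.
Variable R : realType.
Local Notation mu := (@lebesgue_measure R).

Lemma is_derive_continuous (f : R -> R) (x df : R) :
  is_derive x 1 f df -> {for x, continuous f}.
Proof. by move=> h; apply/differentiable_continuous/derivable1_diffP. Qed.

Lemma itv_integrable (f : R -> R) (s t M : R) :
    measurable_fun setT f -> (forall x, s <= x <= t -> `|f x| <= M) ->
  mu.-integrable `[s, t] (EFin \o f).
Proof.
move=> mf fM; apply: measurable_bounded_integrable => //.
- by rewrite /= lebesgue_measure_itv /=; case: ifP => // _; rewrite -EFinD ltry.
- exact: measurable_funS mf.
- exists M; split; first exact: num_real.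
  move=> N MN x /=; rewrite in_itv /= => xst.
  exact: le_trans (fM _ xst) (ltW MN).
Qed.

Lemma Rintegral_itv_norm_le (f : R -> R) (s t M : R) : s <= t ->
    measurable_fun setT f -> (forall x, s <= x <= t -> `|f x| <= M) ->
  `|\int[mu]_(x in `[s, t]) f x| <= M * (t - s).
Proof.
move=> st mf fM; have intf := itv_integrable mf fM.
apply: le_trans (le_normr_Rintegral _ intf) _ => //.
have -> : M * (t - s) = \int[mu]_(x in `[s, t]) M.
  rewrite Rintegral_cst //; congr (_ * _).
  rewrite /= lebesgue_measure_itv /= lte_fin; case: ltP => // ts.
  by apply/eqP; rewrite subr_eq0 eq_le ts st.
apply: le_Rintegral => //.
- apply: (@itv_integrable (fun x => `|f x|) s t M).
    exact: measurableT_comp.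
  by move=> x /fM; rewrite normr_id.
- by apply: (@itv_integrable (fun=> M) s t `|M|) => //.
Qed.

Lemma Rintegral_itv_split (f : R -> R) (s t M z : R) : s <= z -> z <= t ->
    measurable_fun setT f -> (forall x, s <= x <= t -> `|f x| <= M) ->
  \int[mu]_(x in `[s, t]) f x =
  \int[mu]_(x in `[s, z]) f x + \int[mu]_(x in `[z, t]) f x.
Proof.
move=> sz zt mf fM; have intf := itv_integrable mf fM.
have := @Rintegral_itvB R f (BLeft s) (BRight t) z intf.
rewrite !bnd_simp => /(_ sz zt) h; rewrite -[LHS](subrK (\int[mu]_(x in `[s, z]) f x)).
rewrite h addrC; congr (_ + _); rewrite Rintegral_itv_obnd_cbnd//.
apply: integrableS intf => //.
by apply: subset_itvr; rewrite bnd_simp.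
Qed.

Variables (phi phi' phi'' : R -> R).
Hypothesis dphi : forall x : R, is_derive x 1 phi (phi' x).
Hypothesis dphi' : forall x : R, is_derive x 1 phi' (phi'' x).
Hypothesis cphi'' : continuous phi''.

Let cphi : continuous phi.
Proof. by move=> x; exact: is_derive_continuous (dphi x). Qed.

Let cphi' : continuous phi'.
Proof. by move=> x; exact: is_derive_continuous (dphi' x). Qed.

Let mphase k th : measurable_fun setT (fun x => k * phi x + th).
Proof.
apply: continuous_measurable_fun => x.
by apply: cvgD; [apply: cvgMr; exact: cphi|exact: cvg_cst].
Qed.

Let mcos k th : measurable_fun setT (fun x => cos (k * phi x + th)).
Proof.
apply: (measurableT_comp (f := cos)) (mphase k th).
by apply: continuous_measurable_fun => x; exact: continuous_cos.
Qed.

(* [d/dx (sin (k phi + th) / phi') = k cos (k phi + th) - sin (k phi + th) phi'' / phi'^2] *)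
Lemma nonstationary_cos_integral (s t th : R) : s < t ->
    (forall x, s <= x <= t -> phi' x != 0) ->
  exists C : R, forall k : R, 0 < k -> `|\int[mu]_(x in `[s, t]) cos (k * phi x + th)| <= C / k.
Proof.
move=> st phi'0.
pose g x := phi'' x / phi' x ^+ 2.
have cg x : s <= x <= t -> {for x, continuous g}.
  move=> /phi'0 p0; apply: cvgM; first exact: cphi''.
  apply: cvgV; first by rewrite sqrf_eq0.
  by apply: (@continuous_comp _ _ _ phi' (fun y => y ^+ 2)); [exact: cphi'|exact: exprn_continuous].
have cgw : {within `[s, t], continuous g}.
  by apply: continuous_in_subspaceT => x; rewrite inE /= in_itv /= => /cg.
have /compact_bounded : compact (g @` `[s, t]).
  by apply: continuous_compact => //; exact: segment_compact.
move=> [B [_ /(_ (`|B| + 1))]] => /(_ _) gB.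
have {}gB x : s <= x <= t -> `|g x| <= `|B| + 1.
  move=> xst; apply: gB; first by rewrite ltr_pwDr// ler_norm.
  by exists x => //=; rewrite in_itv.
exists (`|(phi' t)^-1| + `|(phi' s)^-1| + (`|B| + 1) * (t - s)) => k k0.
pose F x := sin (k * phi x + th) / phi' x.
pose f x := k * cos (k * phi x + th) - sin (k * phi x + th) * g x.
have dF x : s <= x <= t -> is_derive x 1 F (f x).
  move=> xst.
  have h1 : is_derive x 1 (fun y => k * phi y + th) (k * phi' x).
    have := is_deriveD (is_deriveZ k (dphi x)) (is_derive_cst th x 1).
    by rewrite addr0.
  have h2 := @is_derive1_comp R sin (fun y => k * phi y + th) x _ _ (is_derive_sin _) h1.
  have h3 := is_deriveV (phi'0 _ xst) (dphi' x).
  apply: is_derive_eq (is_deriveM h2 h3) _.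
  by rewrite /f /g /GRing.scale /=; have p0 := phi'0 _ xst; field.
have csin x : {for x, continuous (fun x => sin (k * phi x + th))}.
  apply: (@continuous_comp _ _ _ (fun x => k * phi x + th) sin); last exact: continuous_sin.
  by apply: cvgD; [apply: cvgMr; exact: cphi|exact: cvg_cst].
have ccos x : {for x, continuous (fun x => cos (k * phi x + th))}.
  apply: (@continuous_comp _ _ _ (fun x => k * phi x + th) cos); last exact: continuous_cos.
  by apply: cvgD; [apply: cvgMr; exact: cphi|exact: cvg_cst].
have cF x : s <= x <= t -> {for x, continuous F}.
  by move=> /dF; exact: is_derive_continuous.
have csg : {within `[s, t], continuous (fun x => sin (k * phi x + th) * g x)}.
  apply: continuous_in_subspaceT => x; rewrite inE /= in_itv /= => xst.
  by apply: cvgM; [exact: csin|exact: cg].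
have cc : {within `[s, t], continuous (fun x => cos (k * phi x + th))}.
  by apply: continuous_in_subspaceT => x _; exact: ccos.
have ftc : \int[mu]_(x in `[s, t]) f x = F t - F s.
  rewrite /Rintegral (@continuous_FTC2 _ f F s t st) //.
  - apply: continuous_in_subspaceT => x; rewrite inE /= in_itv /= => xst.
    apply: cvgB; first by apply: cvgMr; exact: ccos.
    by apply: cvgM; [exact: csin|exact: cg].
  - split.
    + move=> x; rewrite in_itv /= => /andP[sx xt].
      by have := dF x; rewrite !ltW// => /(_ isT) [].
    + by apply: cvg_at_right_filter; apply: cF; rewrite lexx ltW.
    + by apply: cvg_at_left_filter; apply: cF; rewrite lexx ltW.
  - move=> x; rewrite in_itv /= => /andP[sx xt].
    rewrite derive1E; apply: derive_val.
    by apply: dF; rewrite !ltW.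
have ic : mu.-integrable `[s, t] (EFin \o (fun x => cos (k * phi x + th))).
  exact: continuous_compact_integrable (@segment_compact _ _ _) cc.
have isg : mu.-integrable `[s, t] (EFin \o (fun x => sin (k * phi x + th) * g x)).
  exact: continuous_compact_integrable (@segment_compact _ _ _) csg.
have ikc : mu.-integrable `[s, t] (EFin \o (fun x => k * cos (k * phi x + th))).
  apply: continuous_compact_integrable (@segment_compact _ _ _) _.
  by apply: continuous_in_subspaceT => x _; apply: cvgMr; exact: ccos.
move: ftc; rewrite /f RintegralB// RintegralZl// => /eqP.
rewrite subr_eq => /eqP e.
rewrite ler_pdivlMr // -[X in _ * X](gtr0_norm k0) -normrM mulrC e /F.
apply: le_trans (ler_normD _ _) _; apply: lerD.
  apply: le_trans (ler_normB _ _) _; rewrite !normrM.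
  by apply: lerD; apply: ler_piMl => //; exact: sin_max.
apply: le_trans (le_normr_Rintegral _ isg) _ => //.
have -> : (`|B| + 1) * (t - s) = \int[mu]_(x in `[s, t]) (`|B| + 1).
  by rewrite Rintegral_cst //= lebesgue_measure_itv /= lte_fin st.
apply: le_Rintegral => //.
- exact: integrable_norm isg.
- by apply: (@itv_integrable (fun=> `|B| + 1) s t `| (`|B| + 1) |).
- move=> x; rewrite /= in_itv /= => xst; rewrite normrM -[leRHS]mul1r.
  by apply: ler_pM => //; [exact: sin_max|exact: gB].
Qed.

Let cosM k th x : `|cos (k * phi x + th)| <= 1.
Proof. exact: cos_max. Qed.

(** Induction on the list of candidate zeros, cutting the segment at each one that is interior. Once
    the list is empty, zeros can remain only at the two ends; removing a short piece at each end
    leaves a segment where the [C / k] bound applies. *)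
Lemma finite_zeros_cos_integral (zs : seq R) (s t th : R) : s <= t ->
    (forall x, s < x < t -> phi' x = 0 -> x \in zs) ->
  \int[mu]_(x in `[s, t]) cos (k * phi x + th) @[k --> +oo] --> (0 : R).
Proof.
elim: zs s t => [|z zs IH] s t st zst; last first.
  have [/andP[sz zt]|szt] := boolP (s < z < t); last first.
    apply: IH => // x xst /(zst _ xst); rewrite inE => /orP[/eqP xz|//].
    by rewrite xz (negPf szt) in xst.
  have split k : \int[mu]_(x in `[s, t]) cos (k * phi x + th) =
      \int[mu]_(x in `[s, z]) cos (k * phi x + th) +
      \int[mu]_(x in `[z, t]) cos (k * phi x + th).
    by apply: (@Rintegral_itv_split _ s t 1) => //; exact: ltW.
  under eq_fun do rewrite split.
  rewrite -(addr0 (0 : R)); apply: cvgD; apply: IH; try exact: ltW.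
  - move=> x /andP[sx xz] /zst; rewrite sx (lt_trans xz zt) => /(_ isT).
    by rewrite inE (lt_eqF xz).
  - move=> x /andP[zx xt] /zst; rewrite xt (lt_trans sz zx) => /(_ isT).
    by rewrite inE (gt_eqF zx).
apply/cvgr0Pnorm_le => e e0.
have [ts|{}st] := leP t s.
  near=> k; apply: le_trans (@Rintegral_itv_norm_le _ s t 1 _ _ _) _ => //.
  by rewrite mul1r; apply: le_trans (ltW e0); rewrite subr_le0.
(* The two removed ends cost at most [e / 4] each, which leaves [e / 2] for the middle; the bound by
   a third of the length keeps the middle nondegenerate. *)
pose d := Num.min (e / 4) ((t - s) / 3).
have d0 : 0 < d by rewrite lt_min !divr_gt0// subr_gt0.
have de : d <= e / 4 by rewrite ge_min lexx.
have dts : d <= (t - s) / 3 by rewrite ge_min lexx orbT.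
have st' : s + d < t - d by lra.
have [|C HC] := @nonstationary_cos_integral (s + d) (t - d) th st'.
  by move=> x xst; apply/negP => /eqP /zst; rewrite in_nil => /(_ _)/negP; apply; lra.
near=> k.
have k0 : 0 < k by near: k; apply: nbhs_pinfty_gt; rewrite num_real.
have kC : `|C| / (e / 2) <= k by near: k; apply: nbhs_pinfty_ge; rewrite num_real.
rewrite (@Rintegral_itv_split _ s t 1 (s + d)) //; try lra.
rewrite (@Rintegral_itv_split _ (s + d) t 1 (t - d)) //; try lra.
have h1 := @Rintegral_itv_norm_le _ s (s + d) 1 ltac:(lra) (mcos k th) (fun x _ => cosM k th x).
have h2 := @Rintegral_itv_norm_le _ (t - d) t 1 ltac:(lra) (mcos k th) (fun x _ => cosM k th x).
have h3 : C / k <= e / 2.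
  rewrite ler_pdivrMr // mulrC -ler_pdivrMr ?divr_gt0//.
have := HC k k0; set I2 := Rintegral _ _ _ in h1 *; set I3 := Rintegral _ _ _; set I4 := Rintegral _ _ _ in h2 *.
move=> h4; apply: le_trans (ler_normD _ _) _.
apply: le_trans (lerD h1 (le_trans (ler_normD _ _) (lerD h4 h2))) _.
lra.
Unshelve. all: by end_near.
Qed.

(* Replacing [F k] by its value at the left end of each of [2 ^ n] equal
   subintervals costs at most [M (t - s)^2 / 2^n]. *)
Lemma lipschitz_cos_integral (F : R -> R -> R) (s0 t0 M K th : R) : s0 <= t0 ->
    (forall k, measurable_fun setT (F k)) ->
    (forall k x, K <= k -> s0 <= x <= t0 -> `|F k x| <= M) ->
    (forall k x y, K <= k -> s0 <= x <= t0 -> s0 <= y <= t0 ->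
       `|F k x - F k y| <= M * `|x - y|) ->
    (forall s t, s0 <= s -> s <= t -> t <= t0 ->
       \int[mu]_(x in `[s, t]) cos (k * phi x + th) @[k --> +oo] --> (0 : R)) ->
  \int[mu]_(x in `[s0, t0]) (F k x * cos (k * phi x + th)) @[k --> +oo] --> (0 : R).
Proof.
move=> st0 mF FM FL null.
have mFc k : measurable_fun setT (fun x => F k x * cos (k * phi x + th)).
  exact: measurable_funM.
have M0 : 0 <= M.
  by apply: le_trans (FM K s0 _ _) => //; rewrite !lexx.
have FcM k x : K <= k -> s0 <= x <= t0 -> `|F k x * cos (k * phi x + th)| <= M.
  move=> Kk xst; rewrite normrM -[leRHS]mulr1; apply: ler_pM => //; exact: FM.
(* The slack [e] is quantified inside the induction so that each bisection can pass half of it to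
   either side. The main term halves by itself, since two squares of half the length add up to half
   of the square. *)
have claim n : forall s t, s0 <= s -> s <= t -> t <= t0 -> forall e, 0 < e ->
    \forall k \near +oo, `|\int[mu]_(x in `[s, t]) (F k x * cos (k * phi x + th))|
      <= M * (t - s) ^+ 2 / 2 ^+ n + e.
  elim: n => [|n IH] s t ss st tt e e0.
    have /cvgr0Pnorm_le/(_ (e / (M + 1))) := null _ _ ss st tt.
    rewrite divr_gt0//; last by lra.
    move=> /(_ isT) small; near=> k.
    have Kk : K <= k by near: k; apply: nbhs_pinfty_ge; rewrite num_real.
    have sin : s0 <= s <= t0 by rewrite ss (le_trans st).
    have xin x : s <= x <= t -> s0 <= x <= t0.
      by move=> /andP[sx xt]; rewrite (le_trans ss) ?(le_trans xt).
    have -> : \int[mu]_(x in `[s, t]) (F k x * cos (k * phi x + th)) =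
      \int[mu]_(x in `[s, t]) ((F k x - F k s) * cos (k * phi x + th)) +
      F k s * \int[mu]_(x in `[s, t]) cos (k * phi x + th).
      rewrite -RintegralZl //; last exact: (@itv_integrable _ s t 1).
      rewrite -RintegralD //.
      - by apply: eq_Rintegral => x _; rewrite mulrBl subrK.
      - apply: (@itv_integrable _ s t (M * (t - s))).
          by apply: measurable_funM => //; apply: measurable_funB.
        move=> x xst; rewrite normrM -[leRHS]mulr1; apply: ler_pM => //.
        apply: le_trans (FL _ _ _ Kk (xin _ xst) sin) _.
        rewrite ler_wpM2l // ger0_norm; lra.
      - apply: (@itv_integrable _ s t M); first exact: measurable_funM.
        move=> x xst; rewrite normrM -[leRHS]mulr1; apply: ler_pM => //.
        exact: FM.
    apply: le_trans (ler_normD _ _) _; apply: lerD.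
      rewrite expr0 divr1 expr2 mulrA; apply: Rintegral_itv_norm_le => //.
        by apply: measurable_funM => //; apply: measurable_funB.
      move=> x xst; rewrite normrM -[leRHS]mulr1; apply: ler_pM => //.
      apply: le_trans (FL _ _ _ Kk (xin _ xst) sin) _.
      rewrite ler_wpM2l // ger0_norm; lra.
    have small' : `|\int[mu]_(x in `[s, t]) cos (k * phi x + th)| <= e / (M + 1).
      by near: k.
    have M10 : 0 < M + 1 by lra.
    rewrite normrM; apply: le_trans (ler_pM _ _ (FM _ _ Kk sin) small') _ => //.
    rewrite mulrA ler_pdivrMr //; nra.
  pose z := (s + t) / 2.
  have sz : s <= z by rewrite /z; lra.
  have zt : z <= t by rewrite /z; lra.
  have e20 : 0 < e / 2 by rewrite divr_gt0.
  have IH1 := IH s z ss sz (le_trans zt tt) _ e20.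
  have IH2 := IH z t (le_trans ss sz) zt tt _ e20.
  near=> k.
  have Kk : K <= k by near: k; apply: nbhs_pinfty_ge; rewrite num_real.
  rewrite (@Rintegral_itv_split _ s t M z) //; last first.
    by move=> x /andP[sx xt]; apply: FcM => //; rewrite (le_trans ss) ?(le_trans xt).
  apply: le_trans (ler_normD _ _) _.
  have h1 : `|\int[mu]_(x in `[s, z]) (F k x * cos (k * phi x + th))|
      <= M * (z - s) ^+ 2 / 2 ^+ n + e / 2 by near: k.
  have h2 : `|\int[mu]_(x in `[z, t]) (F k x * cos (k * phi x + th))|
      <= M * (t - z) ^+ 2 / 2 ^+ n + e / 2 by near: k.
  apply: le_trans (lerD h1 h2) _; rewrite le_eqVlt; apply/orP; left; apply/eqP.
  by rewrite /z (exprS 2 n); field; rewrite expf_neq0.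
apply/cvgr0Pnorm_le => e e0.
pose B := M * (t0 - s0) ^+ 2.
have B0 : 0 <= B by rewrite mulr_ge0 ?sqr_ge0.
have [n Bn] : exists n, B / 2 ^+ n <= e / 2.
  exists (Num.bound (B / (e / 2))).
  have := archi_boundP (divr_ge0 B0 (ltW (divr_gt0 e0 (ltr0Sn R 1)))).
  set m := Num.bound _ => h.
  rewrite ler_pdivrMr ?exprn_gt0// mulrC -ler_pdivrMr ?divr_gt0//.
  apply: le_trans (ltW h) _.
  by rewrite -natrX ler_nat ltnW // ltn_expl.
have := claim n s0 t0 (lexx _) st0 (lexx _) (e / 2) (divr_gt0 e0 (ltr0Sn R 1)).
apply: filterS => k h; apply: le_trans h _.
by rewrite -/B; lra.
Unshelve. all: by end_near.
Qed.

End Oscillation.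

(** * Integrals over the array *)

Section ArrayIntegral.
Variable R : realType.
Local Notation mu := (@lebesgue_measure R).
Local Notation mu2 := (@lebesgue_measure R \x @lebesgue_measure R)%E.

Lemma measurable_array (a : R) : measurable (array a).
Proof. by apply: measurableX => //; exact: measurable_itv. Qed.

Lemma arrayP (a : R) (u : R * R) :
  array a u <-> (- (a / 2) <= u.1 <= a / 2) /\ (- (a / 2) <= u.2 <= a / 2).
Proof. by rewrite /array /setX /= !in_itv. Qed.

Lemma array_lty (a : R) : (mu2 (array a) < +oo)%E.
Proof.
rewrite /array product_measure1E //= lebesgue_measure_itv /=.
by case: ifP => _; rewrite ?mule0 ?ltry // -EFinD -EFinM ltry.
Qed.

Lemma array_integrable (a M : R) (f : R * R -> R) :
    measurable_fun setT f -> (forall u, array a u -> `|f u| <= M) ->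
  mu2.-integrable (array a) (EFin \o f).
Proof.
move=> mf fM; apply: measurable_bounded_integrable.
- exact: measurable_array.
- exact: array_lty.
- exact: measurable_funS mf.
- exists M; split; first exact: num_real.
  move=> N MN x /= ax; exact: le_trans (fM _ ax) (ltW MN).
Qed.

(** The measurability of the inner integral comes along because dominated convergence in [v] asks
    for it. Both parts result from extending [f] by 0 outside the square. *)
Lemma array_Rintegral_fubini (a M : R) (f : R * R -> R) :
    measurable_fun setT f -> (forall u, array a u -> `|f u| <= M) ->
  (measurable_fun `[- (a / 2), a / 2] (fun v => \int[mu]_(t in `[- (a / 2), a / 2]) f (t, v))) /\
  \int[mu2]_(u in array a) f u =
  \int[mu]_(v in `[- (a / 2), a / 2]) \int[mu]_(t in `[- (a / 2), a / 2]) f (t, v).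
Proof.
move=> mf fM; set I := `[_, _]%classic.
have intf := array_integrable mf fM.
have intr : mu2.-integrable setT ((EFin \o f) \_ (array a)).
  by apply: (iffLR (@integrable_mkcond _ _ _ mu2 (array a) _ _) intf); exact: measurable_array.
have slice v : fubini_G mu ((EFin \o f) \_ (array a)) v =
    ((fun v => (\int[mu]_(t in I) f (t, v))%:E) \_ I) v.
  rewrite /fubini_G /patch; case: ifPn => [vI|vI].
    rewrite /Rintegral fineK; last first.
      apply: integrable_fin_num; first exact: measurable_itv.
      apply: (@itv_integrable _ (fun t => f (t, v)) _ _ M).
        exact: measurableT_comp (pair2_measurable v).
      move=> x xI; apply: fM; apply/arrayP; split => //=.
      by move: vI; rewrite inE /I /= in_itv.
    rewrite [in RHS]integral_mkcond; apply: eq_integral => t _ /=.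
    rewrite /patch; congr (if _ then _ else _).
    by apply/idP/idP => /set_mem; rewrite /array /setX /= => h; apply/mem_set => //=;
      [case: h|split => //=; exact: set_mem].
  rewrite integral0_eq // => t _; rewrite /patch ifF //.
  apply/negbTE; apply: contra vI => /set_mem[_ /= h]; exact/mem_set.
split.
  apply/measurable_EFinP.
  have mG := @eq_measurable_fun _ _ _ _ setT _ _ (fun v _ => slice v) (measurable_fubini_G intr).
  by apply: (iffRL (measurable_restrictT _ _) mG); exact: measurable_itv.
rewrite /Rintegral integral_mkcond -(integral21_prod_meas1 intr).
congr fine; rewrite [RHS]integral_mkcond; apply: eq_integral => v _.
exact: slice.
Qed.

(* The inner integrals over the horizontal slices of the array are bounded and
   tend to 0 off finitely many slices, so dominated convergence applies. *)
Lemma array_slice_cvg0 (a K M : R) (f : R -> R * R -> R) (zs : seq R) :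
    (forall k, measurable_fun setT (f k)) ->
    (forall k u, K <= k -> array a u -> `|f k u| <= M) ->
    (forall v, v \notin zs -> - (a / 2) <= v <= a / 2 ->
      \int[mu]_(t in `[- (a / 2), a / 2]) f k (t, v) @[k --> +oo] --> (0 : R)) ->
  \int[mu2]_(u in array a) f k u @[k --> +oo] --> (0 : R).
Proof.
move=> mf fM null; set I := `[- (a / 2), a / 2]%classic in null *.
have [a0|a0] := ltP a 0.
  have -> : array a = set0.
    by rewrite -subset0 => u /arrayP[]; lra.
  under eq_fun do rewrite Rintegral_set0; exact: cvg_cst.
apply/cvg_pinftyP => u uoo.
(* Dominated convergence is applied along sequences and needs the bound [M] for every index, whereas
   it holds only from [K] on. Truncating the sequence below at [K] changes finitely many terms. *)
pose w n := Num.max K (u n).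
have Kw n : K <= w n by rewrite le_max lexx.
have wu : \forall n \near \oo, w n = u n.
  have /cvgryPge/(_ K) := uoo; apply: filterS => n Kn.
  by apply/max_idPr.
suff h : \int[mu2]_(x in array a) f (w n) x @[n --> \oo] --> (0 : R).
  apply: cvg_trans h; apply: near_eq_cvg; apply: filterS wu => n -> //.
have fub n := array_Rintegral_fubini (mf (w n)) (fun x => fM (w n) x (Kw n)).
under eq_fun do rewrite (fub _).2.
have innerM n v : I v -> `|\int[mu]_(t in I) f (w n) (t, v)| <= M * a.
  rewrite /I /= in_itv /= => vI.
  have := @Rintegral_itv_norm_le _ (fun t => f (w n) (t, v)) (- (a / 2)) (a / 2) M.
  rewrite (_ : a / 2 - - (a / 2) = a); last by lra.
  apply; first lra.
    exact: measurableT_comp (pair2_measurable v).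
  by move=> x xI; apply: fM => //; apply/arrayP.
have [|//||||_ _] := @dominated_convergence _ _ R mu I (measurable_itv _)
  (fun n v => (\int[mu]_(t in I) f (w n) (t, v))%:E) (cst 0%E) (cst (M * a)%:E).
- by move=> n; apply/measurable_EFinP; exact: (fub n).1.
- exists [set` zs]; split => //.
  + by apply: countable_measurable => //; apply: finite_set_countable; exact: finite_seq.
  + by apply: countable_lebesgue_measure0; apply: finite_set_countable; exact: finite_seq.
  + move=> v /= nv; apply: contrapT => vzs; apply: nv => vI.
    apply/fine_cvgP; split; first exact: nearW.
    have /cvg_pinftyP := null v (introN idP vzs) ltac:(by move: vI; rewrite /I /= in_itv).
    apply; apply: cvg_trans uoo; apply: near_eq_cvg.
    by apply: filterS wu => n ->.
- apply: (@itv_integrable _ (cst (M * a)) _ _ `|M * a|) => //.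
- by apply: aeW => v n vI; rewrite lee_fin; exact: innerM.
rewrite integral0 => /fine_cvgP[_].
by [].
Qed.

End ArrayIntegral.

(** * Critical points of the phase on a line *)

Section FiniteZeros.

(* Up to sign the product of [f1 +- f2 +- f3 +- f4] over all choices of signs,
   in terms of the squares [xi = fi ^+ 2]. *)
Definition sign_product (S : comPzRingType) (x1 x2 x3 x4 : S) : S :=
  ((x1 + x2 - x3 - x4) ^+ 2 - 4 * x3 * x4 - 4 * x1 * x2) ^+ 2 - 64 * x1 * x2 * x3 * x4.

Lemma sign_product_eq0 (S : comPzRingType) (f1 f2 f3 f4 : S) :
  f1 + f2 + f3 + f4 = 0 ->
  sign_product (f1 ^+ 2) (f2 ^+ 2) (f3 ^+ 2) (f4 ^+ 2) = 0.
Proof.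
rewrite addrC => /eqP; rewrite addr_eq0 => /eqP ->.
by rewrite /sign_product; ring.
Qed.

(** Homogeneity of degree 4, through which the common denominator of the squared terms of the
    derivative is cleared. *)
Lemma sign_productZ (S : comPzRingType) (d x1 x2 x3 x4 : S) :
  sign_product (d * x1) (d * x2) (d * x3) (d * x4) = d ^+ 4 * sign_product x1 x2 x3 x4.
Proof. by rewrite /sign_product; ring. Qed.

Lemma sign_product_morph (S T : comPzRingType) (f : {rmorphism S -> T}) (x1 x2 x3 x4 : S) :
  f (sign_product x1 x2 x3 x4) = sign_product (f x1) (f x2) (f x3) (f x4).
Proof. by rewrite /sign_product !(rmorphXn, rmorph_nat, rmorphB, rmorphM, rmorphD). Qed.

Variable R : realType.

(** The distance from a moving point of a line to a fixed point: [p] is the coordinate of the foot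
    of the perpendicular and [q] the squared distance to the line. For [q > 0] it is smooth, with
    branch points at [p] plus or minus [i sqrt q]. *)
Definition rdist (p q t : R) : R := Num.sqrt ((t - p) ^+ 2 + q).

Lemma rdist_gt0 p q t : 0 < q -> 0 < rdist p q t.
Proof. by move=> q0; rewrite sqrtr_gt0 ltr_wpDl// sqr_ge0. Qed.

Lemma rdist_sqr p q t : 0 < q -> rdist p q t ^+ 2 = (t - p) ^+ 2 + q.
Proof. by move=> q0; rewrite sqr_sqrtr// addr_ge0 ?sqr_ge0// ltW. Qed.

Definition quad (S : comPzRingType) (p q t : S) : S := (t - p) ^+ 2 + q.

(** A real monic quadratic is determined by one nonreal root: the imaginary part of the equation
    gives [p = p'], then the real part gives [q = q']. *)
Lemma quad_branch_neq0 (p q p' q' : R) : 0 < q -> (p, q) <> (p', q') ->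
  quad p'%:C q'%:C (p +i* Num.sqrt q) != 0.
Proof.
move=> q0 pq; apply/eqP; rewrite /quad expr2.
move=> /eqP; rewrite eq_complex /= => /andP[/eqP re /eqP im].
have sq : Num.sqrt q ^+ 2 = q by rewrite sqr_sqrtr// ltW.
have s0 : 0 < Num.sqrt q by rewrite sqrtr_gt0.
have pp : p = p'.
  have /eqP : (p - p') * Num.sqrt q = 0 by lra.
  by rewrite mulf_eq0 (gt_eqF s0) orbF subr_eq0 => /eqP.
by apply: pq; rewrite -pp in re *; congr pair; move: re sq; nra.
Qed.

(* Clearing denominators in the product of all sign choices gives a polynomial;
   at the complex zero [p1 + i sqrt q1] of the first quadratic all its terms but
   one vanish. *)
Lemma slice_derivative_finite_zeros (c1 p1 q1 c2 p2 q2 c3 p3 q3 c4 p4 q4 : R) :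
    0 < q1 -> 0 < q2 -> 0 < q3 -> 0 < q4 -> c1 != 0 ->
    (p1, q1) <> (p2, q2) -> (p1, q1) <> (p3, q3) -> (p1, q1) <> (p4, q4) ->
  exists zs : seq R, forall t,
    c1 * ((t - p1) / rdist p1 q1 t) + c2 * ((t - p2) / rdist p2 q2 t) +
    c3 * ((t - p3) / rdist p3 q3 t) + c4 * ((t - p4) / rdist p4 q4 t) = 0 -> t \in zs.
Proof.
move=> q1_gt0 q2_gt0 q3_gt0 q4_gt0 c1_neq0 n12 n13 n14.
pose Q (p q : R) := quad p%:C%:P q%:C%:P 'X : {poly R[i]}.
pose P (c p : R) := (c%:C%:P * ('X - p%:C%:P)) ^+ 2 : {poly R[i]}.
pose N := sign_product (P c1 p1 * Q p2 q2 * Q p3 q3 * Q p4 q4)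
  (P c2 p2 * Q p1 q1 * Q p3 q3 * Q p4 q4) (P c3 p3 * Q p1 q1 * Q p2 q2 * Q p4 q4)
  (P c4 p4 * Q p1 q1 * Q p2 q2 * Q p3 q3).
have PE c p z : (P c p).[z] = (c%:C * (z - p%:C)) ^+ 2 by rewrite /P !hornerE.
have QE p q z : (Q p q).[z] = quad p%:C q%:C z by rewrite /Q /quad !hornerE.
have NE z : N.[z] = sign_product
    ((P c1 p1).[z] * (Q p2 q2).[z] * (Q p3 q3).[z] * (Q p4 q4).[z])
    ((P c2 p2).[z] * (Q p1 q1).[z] * (Q p3 q3).[z] * (Q p4 q4).[z])
    ((P c3 p3).[z] * (Q p1 q1).[z] * (Q p2 q2).[z] * (Q p4 q4).[z])
    ((P c4 p4).[z] * (Q p1 q1).[z] * (Q p2 q2).[z] * (Q p3 q3).[z]).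
  by rewrite -horner_evalE sign_product_morph /= /horner_eval !hornerM.
have N0 : N != 0.
  apply/eqP => N0; pose z := p1 +i* Num.sqrt q1.
  have sq : Num.sqrt q1 ^+ 2 = q1 by rewrite sqr_sqrtr// ltW.
  have Qz : (Q p1 q1).[z] = 0.
    rewrite QE /quad expr2; apply/eqP; rewrite eq_complex /=.
    by apply/andP; split; apply/eqP; nra.
  (* Three of the four arguments contain the factor that vanishes at [z], so the sign product
     reduces to the fourth power of the remaining one, whose factors are all nonzero. *)
  have := NE z; rewrite N0 horner0 Qz !(mulr0, mul0r).
  rewrite /sign_product !(mulr0, mul0r, addr0, subr0) -!exprM => /esym/eqP.
  rewrite expf_eq0 /= !mulf_eq0 !QE PE.
  rewrite !(negPf (quad_branch_neq0 _ _)) ?orbF //.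
  rewrite sqrf_eq0 mulf_eq0 eq_complex /= eqxx andbT (negPf c1_neq0) /=.
  rewrite eq_complex /= subrr eqxx /= subr0 => /eqP s0.
  by move: q1_gt0; rewrite -sq s0 expr0n ltxx.
have [rs Nrs] := closed_field_poly_normal N.
(* A real critical point is a complex root of [N] and equals its own real part, so the real parts of
   all roots form a sufficient list. *)
exists (map (@complex.Re R) rs) => t t0.
suff : t%:C \in rs by move=> h; apply/mapP; exists t%:C.
rewrite -root_prod_XsubC -(rootZ _ _ (_ : lead_coef N != 0)) ?lead_coef_eq0// -Nrs.
apply/rootP; rewrite NE !PE !QE.
have e c p : (c%:C * (t%:C - p%:C)) ^+ 2 = ((c * (t - p)) ^+ 2)%:C.
  by rewrite rmorphXn rmorphM rmorphB.
have e' p q : quad p%:C q%:C t%:C = (quad p q t)%:C.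
  by rewrite /quad rmorphD rmorphXn rmorphB.
rewrite !e !e' -!rmorphM -sign_product_morph.
have r0 p q : 0 < q -> rdist p q t != 0 by move=> q0; rewrite gt_eqF ?rdist_gt0.
(* Each argument of the polynomial is [D] times the square of a term of the derivative. The
   hypothesis says that these terms sum to 0, so their sign product vanishes. *)
pose D := quad p1 q1 t * quad p2 q2 t * quad p3 q3 t * quad p4 q4 t.
pose f c p q : R := c * ((t - p) / rdist p q t).
have cf c p q : 0 < q -> (c * (t - p)) ^+ 2 = quad p q t * f c p q ^+ 2.
  by move=> q0; rewrite /f /quad -rdist_sqr //; field; exact: r0.
rewrite (cf c1 _ _ q1_gt0) (cf c2 _ _ q2_gt0) (cf c3 _ _ q3_gt0) (cf c4 _ _ q4_gt0).
have -> : sign_product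
  (quad p1 q1 t * f c1 p1 q1 ^+ 2 * quad p2 q2 t * quad p3 q3 t * quad p4 q4 t)
  (quad p2 q2 t * f c2 p2 q2 ^+ 2 * quad p1 q1 t * quad p3 q3 t * quad p4 q4 t)
  (quad p3 q3 t * f c3 p3 q3 ^+ 2 * quad p1 q1 t * quad p2 q2 t * quad p4 q4 t)
  (quad p4 q4 t * f c4 p4 q4 ^+ 2 * quad p1 q1 t * quad p2 q2 t * quad p3 q3 t)
  = sign_product (D * f c1 p1 q1 ^+ 2) (D * f c2 p2 q2 ^+ 2) (D * f c3 p3 q3 ^+ 2)
     (D * f c4 p4 q4 ^+ 2) by congr sign_product; rewrite /D; ring.
by rewrite sign_productZ sign_product_eq0 // mulr0 rmorph0.
Qed.

End FiniteZeros.

(** * Amplitudes and nonconstant phases *)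

Section Amplitudes.
Variable R : realType.
Local Notation mu := (@lebesgue_measure R).
Local Notation mu2 := (@lebesgue_measure R \x @lebesgue_measure R)%E.
Implicit Types (u : R * R) (z : 'cV[R]_3).

Definition array_dist z u : R := enorm (array_point u - z).

(** The squared distance from [z] to the line of the array with second coordinate [v]. *)
Definition slice_q z (v : R) : R := (v - z 1 0) ^+ 2 + x3 z ^+ 2.

Lemma array_distE z u : array_dist z u = rdist (z 0 0) (slice_q z u.2) u.1.
Proof.
rewrite /array_dist /enorm /rdist /slice_q /x3 big_ord_recl big_ord_recl big_ord1 !mxE /=.
rewrite sub0r sqrrN; congr (Num.sqrt (_ + ((_ - z _ _) ^+ 2 + z _ _ ^+ 2))).
- exact: val_inj.
- exact: val_inj.
Qed.

Lemma slice_q_gt0 z v : x3 z != 0 -> 0 < slice_q z v.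
Proof. by move=> z0; rewrite ltr_wpDl ?sqr_ge0 ?exprn_even_gt0. Qed.

Lemma array_dist_ge z u : `|x3 z| <= array_dist z u.
Proof.
rewrite array_distE -sqrtr_sqr ler_wsqrtr // /slice_q addrA lerDr.
by rewrite addr_ge0 ?sqr_ge0.
Qed.

Lemma cV3_ext z z' : z 0 0 = z' 0 0 -> z 1 0 = z' 1 0 -> x3 z = x3 z' -> z = z'.
Proof.
move=> h0 h1 h2; apply/matrixP => i j; rewrite ord1.
case: i => [[|[|[|//]]]] hi.
- by rewrite (_ : Ordinal hi = 0) //; apply: val_inj.
- by rewrite (_ : Ordinal hi = 1) //; apply: val_inj.
- by move: h2; rewrite /x3 (_ : Ordinal hi = ord_max) //; apply: val_inj.
Qed.

(** The difference of the two squared distances is affine in [v] with slope [2 (z'_2 - z_2)]. If the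
    slope is not 0, there is one exceptional line. If it is 0, agreement on any line together with
    equal first coordinates makes the third coordinates equal up to sign, which leaves only [z] and
    its mirror image. *)
Lemma slice_separation z z' : z' <> z -> z' <> mirror z ->
  exists v0, forall v, v != v0 -> (z 0 0, slice_q z v) <> (z' 0 0, slice_q z' v).
Proof.
move=> zz zm.
(* The root of that affine function. With slope 0 the quotient is 0 by convention, a harmless value
   since then no line is exceptional. *)
exists ((z' 1 0 ^+ 2 + x3 z' ^+ 2 - z 1 0 ^+ 2 - x3 z ^+ 2) / (2 * (z' 1 0 - z 1 0))).
move=> v vv0 [e0 eq]; rewrite /slice_q in eq.
have [e1|n1] := eqVneq (z 1 0) (z' 1 0).
  have /eqP : x3 z ^+ 2 = x3 z' ^+ 2 by rewrite e1 in eq; lra.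
  rewrite eqf_sqr => /orP[/eqP e2|/eqP e2].
    by apply: zz; apply: cV3_ext.
  apply: zm; apply: cV3_ext; rewrite /x3 !mxE //=.
  by rewrite -/(x3 z) e2 opprK.
have n1' : z' 1 0 - z 1 0 != 0 by rewrite subr_eq0 eq_sym.
move/negP: vv0; apply; apply/eqP.
have n2 : 2 * (z' 1 0 - z 1 0) != 0 by rewrite mulf_neq0 ?pnatr_eq0.
by apply: (mulIf n2); rewrite divfK //; lra.
Qed.

Lemma rdist_is_derive p q (t : R) : 0 < q -> is_derive t 1 (rdist p q) ((t - p) / rdist p q t).
Proof.
move=> q0; have r0 := rdist_gt0 p t q0.
have h1 : is_derive t 1 (fun t => (t - p) ^+ 2 + q) (2 * (t - p)).
  have h : is_derive t 1 (fun t => t - p) 1.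
    by apply: is_derive_eq (is_deriveB (is_derive_id t 1) (is_derive_cst p t 1)) _; rewrite subr0.
  have := is_deriveD (is_deriveM h h) (is_derive_cst q t 1).
  move=> h'; apply: is_derive_eq h' _; rewrite /GRing.scale /=; lra.
have pos : 0 < (t - p) ^+ 2 + q by rewrite ltr_wpDl ?sqr_ge0.
have := @is_derive1_comp R Num.sqrt (fun t => (t - p) ^+ 2 + q) t _ _ (is_derive1_sqrt pos) h1.
move=> h'; apply: is_derive_eq h' _; rewrite -/(rdist p q t).
by field; rewrite gt_eqF.
Qed.

Lemma rdist'_is_derive p q (t : R) : 0 < q ->
  is_derive t 1 (fun t => (t - p) / rdist p q t) (q / rdist p q t ^+ 3).
Proof.
move=> q0; have r0 : rdist p q t != 0 by rewrite gt_eqF ?rdist_gt0.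
have h : is_derive t 1 (fun t => t - p) 1.
  by apply: is_derive_eq (is_deriveB (is_derive_id t 1) (is_derive_cst p t 1)) _; rewrite subr0.
have h' := is_deriveM h (is_deriveV r0 (rdist_is_derive p t q0)).
apply: is_derive_eq h' _; rewrite /GRing.scale /=.
have := rdist_sqr p t q0; set r := rdist p q t in r0 * => r2.
have -> : q = r ^+ 2 - (t - p) ^+ 2 by rewrite r2; lra.
by field.
Qed.

Lemma rdist_continuous (p q : R) : 0 < q -> continuous (rdist p q).
Proof. by move=> q0 t; exact: is_derive_continuous (rdist_is_derive p t q0). Qed.

(** Each of the other three points shares the branch point of [z1] on at most one line, so three
    values of [v] are discarded. The phase is returned together with a derivative because freezing
    the amplitude calls for a differentiable phase. *)
Lemma slice_cos_cvg0 (c1 c2 c3 c4 th : R) (z1 z2 z3 z4 : 'cV[R]_3) :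
    x3 z1 != 0 -> x3 z2 != 0 -> x3 z3 != 0 -> x3 z4 != 0 -> c1 != 0 ->
    z2 <> z1 -> z2 <> mirror z1 -> z3 <> z1 -> z3 <> mirror z1 ->
    z4 <> z1 -> z4 <> mirror z1 ->
  exists vs : seq R, forall v, v \notin vs ->
  exists phi phi' : R -> R,
   [/\ (forall t, phi t = c1 * array_dist z1 (t, v) + c2 * array_dist z2 (t, v) +
                       c3 * array_dist z3 (t, v) + c4 * array_dist z4 (t, v)),
       (forall t : R, is_derive t 1 phi (phi' t)) &
   forall s t, s <= t ->
     \int[mu]_(x in `[s, t]) cos (k * phi x + th) @[k --> +oo] --> (0 : R)].
Proof.
move=> z1_0 z2_0 z3_0 z4_0 c1_0 n2 m2 n3 m3 n4 m4.
have [v2 h2] := slice_separation n2 m2.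
have [v3 h3] := slice_separation n3 m3.
have [v4 h4] := slice_separation n4 m4.
exists [:: v2; v3; v4] => v; rewrite !inE !negb_or => /and3P[/h2 {}h2 /h3 {}h3 /h4 {}h4].
have q1 := slice_q_gt0 v z1_0; have q2 := slice_q_gt0 v z2_0.
have q3 := slice_q_gt0 v z3_0; have q4 := slice_q_gt0 v z4_0.
have [zs zsP] := slice_derivative_finite_zeros c2 c3 c4 q1 q2 q3 q4 c1_0 h2 h3 h4.
pose r z := rdist (z 0 0 : R) (slice_q z v).
pose phi t := c1 * r z1 t + c2 * r z2 t + c3 * r z3 t + c4 * r z4 t.
pose r' z t := (t - (z 0 0 : R)) / r z t.
pose phi' t := c1 * r' z1 t + c2 * r' z2 t + c3 * r' z3 t + c4 * r' z4 t.
pose r'' z t := slice_q z v / r z t ^+ 3.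
pose phi'' t := c1 * r'' z1 t + c2 * r'' z2 t + c3 * r'' z3 t + c4 * r'' z4 t.
have dphi (t : R) : is_derive t 1 phi (phi' t).
  have d c z : 0 < slice_q z v -> is_derive t 1 (fun t => c * r z t) (c * r' z t).
    by move=> q0; exact: is_deriveZ (rdist_is_derive _ _ q0).
  exact: is_deriveD (is_deriveD (is_deriveD (d c1 z1 q1) (d c2 z2 q2)) (d c3 z3 q3)) (d c4 z4 q4).
have dphi' (t : R) : is_derive t 1 phi' (phi'' t).
  have d c z : 0 < slice_q z v -> is_derive t 1 (fun t => c * r' z t) (c * r'' z t).
    by move=> q0; exact: is_deriveZ (rdist'_is_derive _ _ q0).
  exact: is_deriveD (is_deriveD (is_deriveD (d c1 z1 q1) (d c2 z2 q2)) (d c3 z3 q3)) (d c4 z4 q4).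
have cr'' z : 0 < slice_q z v -> continuous (r'' z).
  move=> q0 t; apply: cvgMr; apply: cvgV; first by rewrite expf_neq0 // gt_eqF ?rdist_gt0.
  apply: (@continuous_comp _ _ _ (r z) (fun y => y ^+ 3)); last exact: exprn_continuous.
  exact: rdist_continuous.
have cphi'' : continuous phi''.
  move=> t; repeat apply: cvgD; apply: cvgMr; exact: cr''.
exists phi, phi'; split=> // [t|s t st].
  by rewrite /phi /r !array_distE.
by apply: (finite_zeros_cos_integral dphi dphi' cphi'' (zs := zs)) => // x _ /zsP.
Qed.

Section Fixed.
Variable a : R.

(* The frequency enters only through [K <= k]: one constant serves all large
   frequencies, but no limit of [F k] is required. *)
Definition real_amp (F : R -> R * R -> R) : Prop :=
  (forall k, measurable_fun setT (F k)) /\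
  exists M K, 0 <= M /\ forall k u, K <= k -> array a u ->
    `|F k u| <= M /\
    forall v, array a v -> `|F k u - F k v| <= M * (`|u.1 - v.1| + `|u.2 - v.2|).

Lemma real_amp_bounded (B : R -> R) M K : (forall k, K <= k -> `|B k| <= M) ->
  real_amp (fun k _ => B k).
Proof.
move=> BM; split=> [k|]; first exact: measurable_cst.
exists `|M|, K; split=> // k u Kk _; split.
  exact: le_trans (BM _ Kk) (ler_norm _).
by move=> v _; rewrite subrr normr0 mulr_ge0 // addr_ge0.
Qed.

Lemma real_amp_cst (c : R) : real_amp (fun _ _ => c).
Proof. by apply: (@real_amp_bounded (fun=> c) `|c| 0). Qed.

Lemma real_amp_fst : real_amp (fun _ u => u.1).
Proof.
split=> [k|]; first exact: measurable_fst.
exists (1 + `|a|), 0; split=> [|k u _ /arrayP[ua ub]]; first by rewrite addr_ge0.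
have := ler_norm a; split; first by rewrite ler_norml; lra.
move=> v _; have := normr_ge0 (u.1 - v.1); have := normr_ge0 (u.2 - v.2).
have := normr_ge0 a; nra.
Qed.

Lemma real_amp_snd : real_amp (fun _ u => u.2).
Proof.
split=> [k|]; first exact: measurable_snd.
exists (1 + `|a|), 0; split=> [|k u _ /arrayP[ua ub]]; first by rewrite addr_ge0.
have := ler_norm a; split; first by rewrite ler_norml; lra.
move=> v _; have := normr_ge0 (u.1 - v.1); have := normr_ge0 (u.2 - v.2).
have := normr_ge0 a; nra.
Qed.

Lemma real_ampD F G : real_amp F -> real_amp G -> real_amp (fun k u => F k u + G k u).
Proof.
move=> [mF [M [K [M0 FM]]]] [mG [M' [K' [M'0 GM]]]]; split=> [k|].
  exact: measurable_funD.
exists (M + M'), (Num.max K K'); split=> [|k u]; first exact: addr_ge0.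
rewrite ge_max => /andP[Kk K'k] ua.
have [F1 F2] := FM k u Kk ua; have [G1 G2] := GM k u K'k ua; split.
  exact: le_trans (ler_normD _ _) (lerD F1 G1).
move=> v va; rewrite opprD addrACA mulrDl.
exact: le_trans (ler_normD _ _) (lerD (F2 _ va) (G2 _ va)).
Qed.

Lemma real_ampN F : real_amp F -> real_amp (fun k u => - F k u).
Proof.
move=> [mF [M [K [M0 FM]]]]; split=> [k|]; first exact: measurable_funN.
exists M, K; split=> // k u Kk ua; have [F1 F2] := FM k u Kk ua; rewrite normrN.
by split=> // v va; rewrite -opprD normrN; exact: F2.
Qed.

Lemma real_ampM F G : real_amp F -> real_amp G -> real_amp (fun k u => F k u * G k u).
Proof.
move=> [mF [M [K [M0 FM]]]] [mG [M' [K' [M'0 GM]]]]; split=> [k|].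
  exact: measurable_funM.
have MM0 : 0 <= M * M' by exact: mulr_ge0.
exists (2 * (M * M')), (Num.max K K'); split=> [|k u]; first exact: mulr_ge0.
rewrite ge_max => /andP[Kk K'k] ua.
have [F1 F2] := FM k u Kk ua; have [G1 G2] := GM k u K'k ua; split.
  by rewrite normrM; apply: le_trans (ler_pM _ _ F1 G1) _ => //; lra.
move=> v va; have [G3 _] := GM k v K'k va.
rewrite (_ : _ - _ = F k u * (G k u - G k v) + (F k u - F k v) * G k v); last by ring.
apply: le_trans (ler_normD _ _) _; rewrite !normrM.
apply: le_trans (lerD (ler_pM _ _ F1 (G2 _ va)) (ler_pM _ _ (F2 _ va) G3)) _ => //.
by rewrite le_eqVlt; apply/orP; left; apply/eqP; ring.
Qed.

Lemma measurable_inv : measurable_fun setT (fun x : R => x^-1).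
Proof.
(* Squaring makes the base nonnegative, where the real power of exponent [-1] is the inverse; at 0
   both sides are 0. *)
rewrite (_ : (fun x => _) = (fun x => x * (x ^+ 2) `^ (- 1))).
  apply: measurable_funM => //.
  apply: (@measurableT_comp _ _ _ _ _ _ (@powR R ^~ (-1)) _ (fun x : R => x ^+ 2)).
    exact: measurable_powR.
  exact: measurable_funX.
apply/funext => x; rewrite powR_inv1 ?sqr_ge0 //.
have [->|x0] := eqVneq x 0; first by rewrite invr0 mul0r.
by field.
Qed.

Lemma real_ampV F c K : 0 < c -> (forall k u, K <= k -> array a u -> c <= F k u) ->
  real_amp F -> real_amp (fun k u => (F k u)^-1).
Proof.
move=> c0 cF [mF [M [K' [M0 FM]]]]; split=> [k|].
  exact: (measurableT_comp measurable_inv).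
have ci0 : 0 < c^-1 by rewrite invr_gt0.
exists (c^-1 + M * c^-1 ^+ 2), (Num.max K K'); split=> [|k u].
  by rewrite addr_ge0 ?mulr_ge0 ?sqr_ge0// ltW.
rewrite ge_max => /andP[Kk K'k] ua; have cu := cF k u Kk ua.
have Fu0 : 0 < F k u by exact: lt_le_trans cu.
have iF w : array a w -> `|(F k w)^-1| <= c^-1.
  move=> wa; have cw := cF k w Kk wa; have Fw0 : 0 < F k w by exact: lt_le_trans cw.
  by rewrite gtr0_norm ?invr_gt0 // lef_pV2 ?posrE.
split.
  by apply: le_trans (iF _ ua) _; rewrite lerDl mulr_ge0 ?sqr_ge0.
move=> v va; have cv := cF k v Kk va; have Fv0 : 0 < F k v by exact: lt_le_trans cv.
have -> : (F k u)^-1 - (F k v)^-1 = - ((F k u - F k v) * ((F k u)^-1 * (F k v)^-1)).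
  by field; rewrite !gt_eqF.
rewrite normrN !normrM; have [_ F2] := FM k u K'k ua.
apply: le_trans (ler_pM _ _ (F2 _ va) (ler_pM _ _ (iF _ ua) (iF _ va))) _ => //.
rewrite -expr2 mulrAC ler_wpM2r ?addr_ge0//.
by rewrite lerDr ltW.
Qed.

(** After multiplication by the sum of the two distances, the left side becomes a difference of
    squares in which the third coordinate cancels; each horizontal coordinate is dominated by its
    distance. *)
Lemma array_dist_lip z u v : `|array_dist z u - array_dist z v| <= `|u.1 - v.1| + `|u.2 - v.2|.
Proof.
pose e w : (R * R) := (w.1 - z 0 0, w.2 - z 1 0).
have sq w : array_dist z w ^+ 2 = (e w).1 ^+ 2 + ((e w).2 ^+ 2 + x3 z ^+ 2).
  by rewrite array_distE /rdist sqr_sqrtr /slice_q // ?addr_ge0 ?sqr_ge0.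
have ge0 w : 0 <= array_dist z w by rewrite array_distE sqrtr_ge0.
have le1 w : `|(e w).1| <= array_dist z w.
  rewrite -(ger0_norm (ge0 w)) -ler_sqr ?nnegrE // !real_normK ?num_real // sq.
  by rewrite lerDl addr_ge0 ?sqr_ge0.
have le2 w : `|(e w).2| <= array_dist z w.
  rewrite -(ger0_norm (ge0 w)) -ler_sqr ?nnegrE // !real_normK ?num_real // sq.
  by rewrite addrCA lerDl addr_ge0 ?sqr_ge0.
have [s0|s0] := leP (array_dist z u + array_dist z v) 0.
  have -> : array_dist z u = 0 by have := ge0 u; have := ge0 v; lra.
  have -> : array_dist z v = 0 by have := ge0 u; have := ge0 v; lra.
  by rewrite subrr normr0 addr_ge0.
rewrite -(ler_pM2r s0) -[X in _ * X <= _](gtr0_norm s0) -normrM -subr_sqr !sq.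
have -> : (e u).1 ^+ 2 + ((e u).2 ^+ 2 + x3 z ^+ 2) - ((e v).1 ^+ 2 + ((e v).2 ^+ 2 + x3 z ^+ 2))
  = (u.1 - v.1) * ((e u).1 + (e v).1) + (u.2 - v.2) * ((e u).2 + (e v).2).
  by rewrite /e /=; ring.
apply: le_trans (ler_normD _ _) _; rewrite [leRHS]mulrDl.
apply: lerD; rewrite normrM; apply: ler_wpM2l => //; apply: le_trans (ler_normD _ _) _.
  by apply: lerD; exact: le1.
by apply: lerD; exact: le2.
Qed.

Lemma measurable_array_dist z : measurable_fun setT (array_dist z).
Proof.
have -> : array_dist z = fun u => Num.sqrt ((u.1 - z 0 0) ^+ 2 + ((u.2 - z 1 0) ^+ 2 + x3 z ^+ 2)).
  by apply/funext => u; rewrite array_distE.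
apply: (@measurableT_comp _ _ _ _ _ _ (@Num.sqrt R)).
  by apply: continuous_measurable_fun => x; exact: sqrt_continuous.
apply: measurable_funD; first by apply: measurable_funX; exact: measurable_funB.
by apply: measurable_funD => //; apply: measurable_funX; exact: measurable_funB.
Qed.

Lemma real_amp_array_dist z : real_amp (fun _ u => array_dist z u).
Proof.
split=> [k|]; first exact: measurable_array_dist.
have d0 : 0 <= array_dist z (0, 0) by rewrite array_distE sqrtr_ge0.
exists (1 + (array_dist z (0, 0) + `|a|)), 0; split=> [|k u _ ua].
  by rewrite !addr_ge0.
split=> [|v va].
  have := le_trans (ler_norm _) (array_dist_lip z u (0, 0)); rewrite /= !subr0 => h0.
  move/arrayP: ua => [u1 u2].
  have h1 : `|u.1| <= `|a| / 2 by rewrite ler_norml; have := ler_norm a; lra.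
  have h2 : `|u.2| <= `|a| / 2 by rewrite ler_norml; have := ler_norm a; lra.
  by rewrite ger0_norm; [lra|rewrite array_distE sqrtr_ge0].
apply: le_trans (array_dist_lip z u v) _; rewrite ler_peMl ?addr_ge0 //.
by rewrite lerDl addr_ge0.
Qed.

Lemma real_amp_array_distV z : x3 z != 0 -> real_amp (fun _ u => (array_dist z u)^-1).
Proof.
move=> z0; apply: (@real_ampV _ `|x3 z| 0); first by rewrite normr_gt0.
  by move=> k u _ _; exact: array_dist_ge.
exact: real_amp_array_dist.
Qed.

(* The phase is nonconstant on the array because the first of its four distance
   functions is not cancelled by the other three. *)
Lemma real_amp_cos_cvg0 (F : R -> R * R -> R) (c1 c2 c3 c4 th : R) (z1 z2 z3 z4 : 'cV[R]_3) :
    0 < a -> real_amp F ->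
    x3 z1 != 0 -> x3 z2 != 0 -> x3 z3 != 0 -> x3 z4 != 0 -> c1 != 0 ->
    z2 <> z1 -> z2 <> mirror z1 -> z3 <> z1 -> z3 <> mirror z1 ->
    z4 <> z1 -> z4 <> mirror z1 ->
  \int[mu2]_(u in array a) (F k u * cos (k * (c1 * array_dist z1 u + c2 * array_dist z2 u +
     c3 * array_dist z3 u + c4 * array_dist z4 u) + th)) @[k --> +oo] --> (0 : R).
Proof.
move=> a0 [mF [M [K [M0 FM]]]] z1_0 z2_0 z3_0 z4_0 c1_0 n2 m2 n3 m3 n4 m4.
have [vs vsP] := slice_cos_cvg0 c2 c3 c4 th z1_0 z2_0 z3_0 z4_0 c1_0 n2 m2 n3 m3 n4 m4.
have mcos : measurable_fun setT (@cos R).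
  by apply: continuous_measurable_fun => x; exact: continuous_cos.
apply: (@array_slice_cvg0 _ a K M _ vs).
- move=> k; apply: measurable_funM => //; apply: (measurableT_comp mcos).
  apply: measurable_funD => //; apply: measurable_funM => //.
  by do 3 (apply: measurable_funD; last by apply: measurable_funM => //; exact: measurable_array_dist);
    apply: measurable_funM => //; exact: measurable_array_dist.
- move=> k u Kk ua; have [F1 _] := FM k u Kk ua.
  by rewrite normrM -[leRHS]mulr1; apply: ler_pM => //; exact: cos_max.
move=> v /vsP[phi [phi' [phiE dphi null]]] va.
under eq_fun do under eq_Rintegral do rewrite -phiE.
apply: (lipschitz_cos_integral dphi (F := fun k t => F k (t, v)) (M := M) (K := K)).
- lra.
- by move=> k; exact: measurableT_comp (pair2_measurable v).
- by move=> k x Kk xa; have [] := FM k (x, v) Kk ((arrayP a (x, v)).2 (conj xa va)).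
- move=> k x y Kk xa ya; have [_] := FM k (x, v) Kk ((arrayP a (x, v)).2 (conj xa va)).
  by move/(_ (y, v) ((arrayP a (y, v)).2 (conj ya va))); rewrite /= subrr normr0 addr0.
- by move=> s t _ st _; exact: null.
Qed.
End Fixed.

End Amplitudes.

(** * Complex and matrix amplitudes, and integrals that vanish as the frequency grows *)

Section ComplexAmplitudes.
Variables (R : realType) (a : R).
Local Notation mu2 := (@lebesgue_measure R \x @lebesgue_measure R)%E.
Local Notation Re := (@complex.Re R).
Local Notation Im := (@complex.Im R).
Implicit Types (u : R * R) (F G : R -> R * R -> R[i]).

Lemma ReD (x y : R[i]) : Re (x + y) = Re x + Re y.
Proof. by case: x y => [? ?] []. Qed.

Lemma ImD (x y : R[i]) : Im (x + y) = Im x + Im y.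
Proof. by case: x y => [? ?] []. Qed.

Lemma ReM (x y : R[i]) : Re (x * y) = Re x * Re y - Im x * Im y.
Proof. by case: x y => [? ?] []. Qed.

Lemma ImM (x y : R[i]) : Im (x * y) = Re x * Im y + Im x * Re y.
Proof. by case: x y => [? ?] []. Qed.

Lemma eq_real_amp (F G : R -> R * R -> R) : (forall k u, F k u = G k u) -> real_amp a F -> real_amp a G.
Proof.
by move=> FG; rewrite (_ : F = G) //; apply/funext => k; apply/funext => u.
Qed.

Definition complex_amp F := real_amp a (fun k u => Re (F k u)) /\ real_amp a (fun k u => Im (F k u)).

Lemma eq_complex_amp F G : (forall k u, F k u = G k u) -> complex_amp F -> complex_amp G.
Proof.
by move=> FG; rewrite (_ : F = G) //; apply/funext => k; apply/funext => u.
Qed.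

Lemma complex_amp_real (f : R -> R * R -> R) : real_amp a f -> complex_amp (fun k u => (f k u)%:C).
Proof. by move=> fr; split => //; exact: real_amp_cst. Qed.

Lemma complex_amp_cst (c : R[i]) : complex_amp (fun _ _ => c).
Proof. by split; exact: real_amp_cst. Qed.

Lemma complex_ampD F G : complex_amp F -> complex_amp G -> complex_amp (fun k u => F k u + G k u).
Proof.
move=> [F1 F2] [G1 G2]; split.
- by apply: eq_real_amp (real_ampD F1 G1) => k u; case: (F k u) (G k u) => [? ?] [].
- by apply: eq_real_amp (real_ampD F2 G2) => k u; case: (F k u) (G k u) => [? ?] [].
Qed.

Lemma complex_ampN F : complex_amp F -> complex_amp (fun k u => - F k u).
Proof.
move=> [F1 F2]; split.
- by apply: eq_real_amp (real_ampN F1) => k u; case: (F k u).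
- by apply: eq_real_amp (real_ampN F2) => k u; case: (F k u).
Qed.

Lemma complex_ampM F G : complex_amp F -> complex_amp G -> complex_amp (fun k u => F k u * G k u).
Proof.
move=> [F1 F2] [G1 G2]; split.
- by apply: eq_real_amp (real_ampD (real_ampM F1 G1) (real_ampN (real_ampM F2 G2))) => k u; rewrite ReM.
- by apply: eq_real_amp (real_ampD (real_ampM F1 G2) (real_ampM F2 G1)) => k u; rewrite ImM.
Qed.

Lemma complex_amp_conj F : complex_amp F -> complex_amp (fun k u => Num.conj (F k u)).
Proof.
move=> [F1 F2]; split.
- by apply: eq_real_amp F1 => k u; case: (F k u).
- by apply: eq_real_amp (real_ampN F2) => k u; case: (F k u).
Qed.

Lemma complex_ampV F c K : 0 < c ->
    (forall k u, K <= k -> array a u -> c <= Re (F k u) ^+ 2 + Im (F k u) ^+ 2) ->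
  complex_amp F -> complex_amp (fun k u => (F k u)^-1).
Proof.
move=> c0 Fc [F1 F2].
have h : real_amp a (fun k u => (Re (F k u) * Re (F k u) + Im (F k u) * Im (F k u))^-1).
  apply: (real_ampV c0 (K := K)); last exact: real_ampD (real_ampM F1 F1) (real_ampM F2 F2).
  by move=> k u Kk ua; rewrite -!expr2; exact: Fc.
split.
- by apply: eq_real_amp (real_ampM F1 h) => k u; case: (F k u) => x y; rewrite -!expr2.
- by apply: eq_real_amp (real_ampN (real_ampM F2 h)) => k u; case: (F k u) => x y; rewrite -!expr2.
Qed.

Lemma complex_amp_sum I (r : seq I) (P : pred I) (F : I -> R -> R * R -> R[i]) :
  (forall i, P i -> complex_amp (F i)) -> complex_amp (fun k u => \sum_(i <- r | P i) F i k u).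
Proof.
move=> FP; elim: r => [|i r IH].
  by apply: eq_complex_amp (complex_amp_cst 0) => k u; rewrite big_nil.
case Pi : (P i); last by apply: eq_complex_amp IH => k u; rewrite big_cons Pi.
by apply: eq_complex_amp (complex_ampD (FP _ Pi) IH) => k u; rewrite big_cons Pi.
Qed.

Lemma complex_amp_prod I (r : seq I) (P : pred I) (F : I -> R -> R * R -> R[i]) :
  (forall i, P i -> complex_amp (F i)) -> complex_amp (fun k u => \prod_(i <- r | P i) F i k u).
Proof.
move=> FP; elim: r => [|i r IH].
  by apply: eq_complex_amp (complex_amp_cst 1) => k u; rewrite big_nil.
case Pi : (P i); last by apply: eq_complex_amp IH => k u; rewrite big_cons Pi.
by apply: eq_complex_amp (complex_ampM (FP _ Pi) IH) => k u; rewrite big_cons Pi.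
Qed.

Definition matrix_amp m n (A : R -> R * R -> 'M[R[i]]_(m, n)) :=
  forall i j, complex_amp (fun k u => A k u i j).

Lemma matrix_amp_cst m n (A : 'M[R[i]]_(m, n)) : matrix_amp (fun _ _ => A).
Proof. by move=> i j; exact: complex_amp_cst. Qed.

Lemma matrix_ampD m n (A B : R -> R * R -> 'M[R[i]]_(m, n)) :
  matrix_amp A -> matrix_amp B -> matrix_amp (fun k u => A k u + B k u).
Proof. by move=> hA hB i j; apply: eq_complex_amp (complex_ampD (hA i j) (hB i j)) => k u; rewrite mxE. Qed.

Lemma matrix_ampN m n (A : R -> R * R -> 'M[R[i]]_(m, n)) :
  matrix_amp A -> matrix_amp (fun k u => - A k u).
Proof. by move=> hA i j; apply: eq_complex_amp (complex_ampN (hA i j)) => k u; rewrite mxE. Qed.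

Lemma matrix_ampZ m n F (A : R -> R * R -> 'M[R[i]]_(m, n)) :
  complex_amp F -> matrix_amp A -> matrix_amp (fun k u => F k u *: A k u).
Proof. by move=> hF hA i j; apply: eq_complex_amp (complex_ampM hF (hA i j)) => k u; rewrite mxE. Qed.

Lemma matrix_ampM m n p (A : R -> R * R -> 'M[R[i]]_(m, n)) (B : R -> R * R -> 'M[R[i]]_(n, p)) :
  matrix_amp A -> matrix_amp B -> matrix_amp (fun k u => A k u *m B k u).
Proof.
move=> hA hB i j.
apply: (@eq_complex_amp (fun k u => \sum_l A k u i l * B k u l j)) => [k u|]; first by rewrite mxE.
by apply: complex_amp_sum => l _; exact: complex_ampM.
Qed.

Lemma matrix_amp_conj m n (A : R -> R * R -> 'M[R[i]]_(m, n)) :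
  matrix_amp A -> matrix_amp (fun k u => mxconj (A k u)).
Proof. by move=> hA i j; apply: eq_complex_amp (complex_amp_conj (hA i j)) => k u; rewrite mxE. Qed.

Lemma matrix_amp_tr m n (A : R -> R * R -> 'M[R[i]]_(m, n)) :
  matrix_amp A -> matrix_amp (fun k u => (A k u)^T).
Proof. by move=> hA i j; apply: eq_complex_amp (hA j i) => k u; rewrite mxE. Qed.

Lemma complex_amp_det n (A : R -> R * R -> 'M[R[i]]_n) : matrix_amp A -> complex_amp (fun k u => \det (A k u)).
Proof.
move=> hA; apply: complex_amp_sum => s _; apply: complex_ampM; first exact: complex_amp_cst.
by apply: complex_amp_prod => i _; exact: hA.
Qed.

(** Cofactors are polynomial in the entries. By Cramer's rule the inverse matrix is then an
    amplitude as soon as the determinant is bounded away from 0. *)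
Lemma matrix_amp_adj n (A : R -> R * R -> 'M[R[i]]_n) : matrix_amp A -> matrix_amp (fun k u => \adj (A k u)).
Proof.
move=> hA i j.
apply: (@eq_complex_amp (fun k u => cofactor (A k u) j i)) => [k u|]; first by rewrite mxE.
apply: complex_ampM; first exact: complex_amp_cst.
apply: (@complex_amp_det _ (fun k u => row' j (col' i (A k u)))) => i' j'.
by apply: eq_complex_amp (hA (lift j i') (lift i j')) => k u; rewrite !mxE.
Qed.

Lemma near_cvg0D (f g h : R -> R) : (\forall k \near +oo, h k = f k + g k) ->
  f k @[k --> +oo] --> (0 : R) -> g k @[k --> +oo] --> (0 : R) ->
  h k @[k --> +oo] --> (0 : R).
Proof.
move=> fg f0 g0.
have /cvgr0Pnorm_le s0 : f k + g k @[k --> +oo] --> (0 : R).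
  by rewrite -(addr0 (0 : R)); apply: cvgD.
by apply/cvgr0Pnorm_le => e e0; apply: filterS2 fg (s0 e e0) => k ->.
Qed.

Definition cintegrable (h : R * R -> R[i]) :=
  mu2.-integrable (array a) (EFin \o (fun u => Re (h u))) /\
  mu2.-integrable (array a) (EFin \o (fun u => Im (h u))).

Definition vanishes (f : R -> R[i]) :=
  (Re (f k) @[k --> +oo] --> (0 : R)) /\ (Im (f k) @[k --> +oo] --> (0 : R)).

Definition eventually_integrable (H : R -> R * R -> R[i]) := exists K, forall k, K <= k -> cintegrable (H k).

(** Integrability is bundled with the limit because the integral of a sum splits only for integrable
    summands; the pair is stable under finite sums. *)
Definition vanishing_integral (H : R -> R * R -> R[i]) :=
  eventually_integrable H /\ vanishes (fun k => cintegral (array a) (H k)).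

Lemma cintegralD (f g : R * R -> R[i]) : cintegrable f -> cintegrable g ->
  cintegral (array a) (fun u => f u + g u) = cintegral (array a) f + cintegral (array a) g.
Proof.
move=> [f1 f2] [g1 g2]; rewrite /cintegral.
under eq_Rintegral do rewrite ReD; under [in X in _ +i* X]eq_Rintegral do rewrite ImD.
by rewrite !RintegralD //; exact: measurable_array.
Qed.

Lemma cintegrableD (f g : R * R -> R[i]) : cintegrable f -> cintegrable g ->
  cintegrable (fun u => f u + g u).
Proof.
move=> [f1 f2] [g1 g2].
split.
- rewrite (_ : EFin \o _ = (EFin \o (fun u => Re (f u))) \+ (EFin \o (fun u => Re (g u))))%E.
    by apply: integrableD => //; exact: measurable_array.
  by apply/funext => u /=; rewrite ReD EFinD.
- rewrite (_ : EFin \o _ = (EFin \o (fun u => Im (f u))) \+ (EFin \o (fun u => Im (g u))))%E.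
    by apply: integrableD => //; exact: measurable_array.
  by apply/funext => u /=; rewrite ImD EFinD.
Qed.

Lemma eq_cintegral (f g : R * R -> R[i]) : (forall u, array a u -> f u = g u) ->
  cintegral (array a) f = cintegral (array a) g.
Proof.
by move=> fg; congr (_ +i* _); apply: eq_Rintegral => u /set_mem /fg ->.
Qed.

Lemma eventually_integrableD (H1 H2 : R -> R * R -> R[i]) :
  eventually_integrable H1 -> eventually_integrable H2 -> eventually_integrable (fun k u => H1 k u + H2 k u).
Proof.
move=> [K1 h1] [K2 h2]; exists (Num.max K1 K2) => k; rewrite ge_max => /andP[k1 k2].
by apply: cintegrableD; [exact: h1|exact: h2].
Qed.

Lemma eventually_integrable_sum I (r : seq I) (P : pred I) (H : I -> R -> R * R -> R[i]) :
  (forall i, P i -> eventually_integrable (H i)) -> eventually_integrable (fun k u => \sum_(i <- r | P i) H i k u).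
Proof.
move=> hH; elim: r => [|i r IH].
  exists 0 => k _; rewrite (_ : (fun u => _) = fun=> 0); last first.
    by apply/funext => u; rewrite big_nil.
  by split; apply: integrable0.
rewrite (_ : (fun k u => _) = fun k u => (if P i then H i k u else 0) +
    \sum_(j <- r | P j) H j k u); last first.
  by apply/funext => k; apply/funext => u; rewrite big_cons; case: ifP => // _; rewrite add0r.
apply: eventually_integrableD => //; case: (boolP (P i)) => [/hH //|_].
by exists 0 => k _; split; apply: integrable0.
Qed.

Lemma vanishing_integralD (H1 H2 : R -> R * R -> R[i]) :
  vanishing_integral H1 -> vanishing_integral H2 -> vanishing_integral (fun k u => H1 k u + H2 k u).
Proof.
move=> [[K1 h1] [c1 c2]] [[K2 h2] [d1 d2]]; split.
  by apply: eventually_integrableD; [exists K1|exists K2].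
have ev : \forall k \near +oo, cintegral (array a) (fun u => H1 k u + H2 k u) =
   cintegral (array a) (H1 k) + cintegral (array a) (H2 k).
  near=> k.
  have k1 : K1 <= k by near: k; apply: nbhs_pinfty_ge; exact: num_real.
  have k2 : K2 <= k by near: k; apply: nbhs_pinfty_ge; exact: num_real.
  by rewrite -cintegralD; [|exact: h1|exact: h2].
split.
- by apply: near_cvg0D c1 d1; apply: filterS ev => k e; rewrite -ReD -e.
- by apply: near_cvg0D c2 d2; apply: filterS ev => k e; rewrite -ImD -e.
Unshelve. all: by end_near.
Qed.

Lemma vanishing_integral0 : vanishing_integral (fun _ _ => 0).
Proof.
split; first by exists 0 => k _; split; apply: integrable0.
have z : cintegral (array a) (fun=> 0) = 0.
  by rewrite /cintegral /= Rintegral_cst ?mul0r //; exact: measurable_array.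
by split; under eq_fun do rewrite z; exact: cvg_cst.
Qed.

Lemma eq_vanishing_integral (H H' : R -> R * R -> R[i]) :
  (forall k u, H k u = H' k u) -> vanishing_integral H -> vanishing_integral H'.
Proof.
by move=> HH'; rewrite (_ : H = H') //; apply/funext => k; apply/funext => u.
Qed.

Lemma vanishing_integral_sum I (r : seq I) (P : pred I) (H : I -> R -> R * R -> R[i]) :
  (forall i, P i -> vanishing_integral (H i)) -> vanishing_integral (fun k u => \sum_(i <- r | P i) H i k u).
Proof.
move=> hH; elim: r => [|i r IH].
  by apply: eq_vanishing_integral vanishing_integral0 => k u; rewrite big_nil.
case Pi : (P i); last by apply: eq_vanishing_integral IH => k u; rewrite big_cons Pi.
by apply: eq_vanishing_integral (vanishing_integralD (hH _ Pi) IH) => k u; rewrite big_cons Pi.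
Qed.

Lemma eq_eventually_integrable K (H H' : R -> R * R -> R[i]) :
    (forall k u, K <= k -> array a u -> H k u = H' k u) -> eventually_integrable H -> eventually_integrable H'.
Proof.
move=> HH' [K' hH]; exists (Num.max K K') => k; rewrite ge_max => /andP[Kk /hH[h1 h2]].
have ma := @measurable_array R a.
by split; [apply: eq_integrable h1|apply: eq_integrable h2];
  [exact: ma|move=> u /set_mem ua; rewrite /= HH'|exact: ma|move=> u /set_mem ua; rewrite /= HH'].
Qed.

Lemma complex_amp_cis_eventually_integrable F (phi : R * R -> R) : measurable_fun setT phi -> complex_amp F ->
  eventually_integrable (fun k u => cis (k * phi u) * F k u).
Proof.
move=> mphi [[m1 [M1 [K1 [M10 F1]]]] [m2 [M2 [K2 [M20 F2]]]]].
exists (Num.max K1 K2) => k; rewrite ge_max => /andP[k1 k2].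
have mk : measurable_fun setT (fun u => k * phi u) by exact: measurable_funM.
have mc : measurable_fun setT (fun u => cos (k * phi u)).
  by apply: (@measurableT_comp _ _ _ _ _ _ (@cos R)) => //;
     apply: continuous_measurable_fun => x; exact: continuous_cos.
have ms : measurable_fun setT (fun u => sin (k * phi u)).
  by apply: (@measurableT_comp _ _ _ _ _ _ (@sin R)) => //;
     apply: continuous_measurable_fun => x; exact: continuous_sin.
have b (x y X Y : R) : `|x| <= 1 -> `|X| <= 1 -> `|y| <= M1 -> `|Y| <= M2 ->
    `|x * y| + `|X * Y| <= M1 + M2.
  move=> *; rewrite !normrM -[M1]mul1r -[M2]mul1r.
  by apply: lerD; apply: ler_pM.
split.
- apply: (array_integrable (M := M1 + M2)) => [|u ua] /=.
    under eq_fun do rewrite ReM /=.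
    by apply: measurable_funB; apply: measurable_funM.
  rewrite ReM /=; apply: le_trans (ler_normB _ _) _; apply: b.
  + exact: cos_max.
  + exact: sin_max.
  + by have [] := F1 k u k1 ua.
  + by have [] := F2 k u k2 ua.
- apply: (array_integrable (M := M1 + M2)) => [|u ua] /=.
    under eq_fun do rewrite ImM /=.
    by apply: measurable_funD; apply: measurable_funM.
  rewrite ImM /= addrC; apply: le_trans (ler_normD _ _) _; apply: b.
  + exact: sin_max.
  + exact: cos_max.
  + by have [] := F1 k u k1 ua.
  + by have [] := F2 k u k2 ua.
Qed.

Lemma complex_amp_cis_vanishing_integral F (c1 c2 c3 c4 : R) (z1 z2 z3 z4 : 'cV[R]_3) :
    0 < a -> complex_amp F ->
    x3 z1 != 0 -> x3 z2 != 0 -> x3 z3 != 0 -> x3 z4 != 0 -> c1 != 0 ->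
    z2 <> z1 -> z2 <> mirror z1 -> z3 <> z1 -> z3 <> mirror z1 ->
    z4 <> z1 -> z4 <> mirror z1 ->
  vanishing_integral (fun k u => cis (k * (c1 * array_dist z1 u + c2 * array_dist z2 u +
     c3 * array_dist z3 u + c4 * array_dist z4 u)) * F k u).
Proof.
move=> a0 cF z1_0 z2_0 z3_0 z4_0 c1_0 n2 m2 n3 m3 n4 m4.
set phi := (fun u => c1 * array_dist z1 u + c2 * array_dist z2 u + c3 * array_dist z3 u + c4 * array_dist z4 u).
have mphi : measurable_fun setT phi.
  by do 3 (apply: measurable_funD; last by apply: measurable_funM => //; exact: measurable_array_dist);
    apply: measurable_funM => //; exact: measurable_array_dist.
split; first exact: complex_amp_cis_eventually_integrable.
have osc f th : real_amp a f ->
    \int[mu2]_(u in array a) (f k u * cos (k * phi u + th)) @[k --> +oo] --> (0 : R).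
  by move=> fr; apply: real_amp_cos_cvg0.
have oscc f : real_amp a f -> \int[mu2]_(u in array a) (f k u * cos (k * phi u)) @[k --> +oo] --> (0 : R).
  by move=> /(osc f 0); under eq_fun do under eq_Rintegral do rewrite addr0.
(* The constant phase shift [th] was carried along for this: a sine is a cosine shifted by a quarter
   period. *)
have oscs f : real_amp a f -> \int[mu2]_(u in array a) (f k u * sin (k * phi u)) @[k --> +oo] --> (0 : R).
  by move=> /(osc f (- (pi / 2))); under eq_fun do under eq_Rintegral do rewrite cosBpihalf.
have int f (g : R -> R) : real_amp a f -> continuous g -> (forall x, `|g x| <= 1) ->
    exists K, forall k, K <= k ->
    mu2.-integrable (array a) (EFin \o (fun u => f k u * g (k * phi u))).
  move=> [mf [M [K [M0 fM]]]] cg g1; exists K => k Kk.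
  apply: (array_integrable (M := M)) => [|u ua].
    apply: measurable_funM => //; apply: (@measurableT_comp _ _ _ _ _ _ g).
      exact: continuous_measurable_fun.
    exact: measurable_funM.
  by rewrite normrM -[M]mulr1; apply: ler_pM => //; have [] := fM k u Kk ua.
have [F1 F2] := cF.
have [K1 i1] := int _ (@cos R) F1 (@continuous_cos R) (@cos_max R).
have [K2 i2] := int _ (@sin R) F1 (@continuous_sin R) (@sin_max R).
have [K3 i3] := int _ (@cos R) F2 (@continuous_cos R) (@cos_max R).
have [K4 i4] := int _ (@sin R) F2 (@continuous_sin R) (@sin_max R).
split; rewrite /cintegral /=.
- have o2 : - (\int[mu2]_(u in array a) (Im (F k u) * sin (k * phi u))) @[k --> +oo] --> (0 : R).
    by rewrite -(oppr0 R); apply: cvgN; exact: oscs.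
  apply: near_cvg0D (oscc _ F1) o2; near=> k; rewrite -RintegralB; first last.
  + by apply: i4; near: k; apply: nbhs_pinfty_ge; exact: num_real.
  + by apply: i1; near: k; apply: nbhs_pinfty_ge; exact: num_real.
  + exact: measurable_array.
  by apply: eq_Rintegral => u _; rewrite ReM /= mulrC [X in _ - X]mulrC.
- apply: near_cvg0D (oscc _ F2) (oscs _ F1); near=> k; rewrite -RintegralD; first last.
  + by apply: i2; near: k; apply: nbhs_pinfty_ge; exact: num_real.
  + by apply: i3; near: k; apply: nbhs_pinfty_ge; exact: num_real.
  + exact: measurable_array.
  by apply: eq_Rintegral => u _; rewrite ImM /= mulrC [X in _ + X]mulrC.
Unshelve. all: by end_near.
Qed.

End ComplexAmplitudes.

(** * Operator norm and determinant *)

Section OperatorNorm.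
Variable R : realType.
Local Notation normc := (@Normc.normc R).

Lemma normc_ge0 (x : R[i]) : 0 <= normc x.
Proof. by case: x => ? ?; rewrite sqrtr_ge0. Qed.

Lemma normc_sqr (x : R[i]) : normc x ^+ 2 = complex.Re x ^+ 2 + complex.Im x ^+ 2.
Proof. by case: x => x y; rewrite sqr_sqrtr ?addr_ge0 ?sqr_ge0. Qed.

Lemma normc_sum I (r : seq I) (P : pred I) (F : I -> R[i]) :
  normc (\sum_(i <- r | P i) F i) <= \sum_(i <- r | P i) normc (F i).
Proof.
elim/big_ind2: _ => [|x x' y y' hx hy|//]; first by rewrite Normc.normc0.
exact: le_trans (le_normcD _ _) (lerD hx hy).
Qed.

Lemma hnorm_ge0 n (v : 'cV[R[i]]_n) : 0 <= hnorm v.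
Proof. exact: sqrtr_ge0. Qed.

Lemma entry_le_hnorm n (v : 'cV[R[i]]_n) i : normc (v i 0) <= hnorm v.
Proof.
rewrite -(ger0_norm (normc_ge0 _)) -sqrtr_sqr ler_wsqrtr // (bigD1 i) //= lerDl.
by apply: sumr_ge0 => j _; exact: sqr_ge0.
Qed.

Lemma hnorm_le_sum n (v : 'cV[R[i]]_n) : hnorm v <= \sum_i normc (v i 0).
Proof.
have s0 : 0 <= \sum_i normc (v i 0) by apply: sumr_ge0 => i _; exact: normc_ge0.
rewrite -[leRHS](ger0_norm s0) -sqrtr_sqr ler_wsqrtr // expr2 mulr_suml.
apply: ler_sum => i _; rewrite expr2 ler_wpM2l ?normc_ge0 // (bigD1 i) //= lerDl.
by apply: sumr_ge0 => j _; exact: normc_ge0.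
Qed.

Lemma hnorm0 n : hnorm (0 : 'cV[R[i]]_n) = 0.
Proof. by rewrite /hnorm big1 ?sqrtr0 // => i _; rewrite mxE Normc.normc0 expr0n. Qed.

Lemma hnorm_mul_le m n (A : 'M[R[i]]_(m, n)) v : hnorm v <= 1 ->
  hnorm (A *m v) <= \sum_i \sum_j normc (A i j).
Proof.
move=> v1; apply: le_trans (hnorm_le_sum _) _; apply: ler_sum => i _.
rewrite mxE; apply: le_trans (normc_sum _ _ _) _; apply: ler_sum => j _.
rewrite Normc.normcM ler_piMr ?normc_ge0 //.
exact: le_trans (entry_le_hnorm _ _) v1.
Qed.

Lemma opnorm_le_sum m n (A : 'M[R[i]]_(m, n)) : opnorm A <= \sum_i \sum_j normc (A i j).
Proof.
apply: ge_sup; last by move=> _ [v /= v1 <-]; exact: hnorm_mul_le.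
by exists (hnorm (A *m 0)), 0 => //=; rewrite hnorm0.
Qed.

(** The supremum is an upper bound only of a nonempty bounded set; the sum of the moduli of the
    entries supplies the bound. *)
Lemma hnorm_le_opnorm m n (A : 'M[R[i]]_(m, n)) v : hnorm v <= 1 ->
  hnorm (A *m v) <= opnorm A.
Proof.
move=> v1; apply: sup_upper_bound; last by exists v.
split; first by exists (hnorm (A *m 0)), 0 => //=; rewrite hnorm0.
by exists (\sum_i \sum_j normc (A i j)) => _ [w /= w1 <-]; exact: hnorm_mul_le.
Qed.

Lemma opnorm_ge0 m n (A : 'M[R[i]]_(m, n)) : 0 <= opnorm A.
Proof.
by apply: le_trans (hnorm_ge0 (A *m 0)) _; apply: hnorm_le_opnorm; rewrite hnorm0.
Qed.

Lemma entry_le_opnorm m n (A : 'M[R[i]]_(m, n)) i j : normc (A i j) <= opnorm A.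
Proof.
have := @hnorm_le_opnorm m n A (delta_mx j 0) _; rewrite -colE => h.
apply: le_trans (h _); first by have := entry_le_hnorm (col j A) i; rewrite mxE.
apply: le_trans (hnorm_le_sum _) _; rewrite (bigD1 j) //= big1 => [|i' ij].
  by rewrite mxE !eqxx Normc.normc1 addr0.
by rewrite mxE (negPf ij) Normc.normc0.
Qed.

Lemma det_mx22 (S : comPzRingType) (A : 'M[S]_2) : \det A = A 0 0 * A 1 1 - A 0 1 * A 1 0.
Proof.
rewrite (expand_det_row _ 0) big_ord_recl big_ord1 /cofactor !det_mx11 !mxE /=.
rewrite expr0 expr1 mul1r mulN1r mulrN.
by congr (A _ _ * A _ _ - A _ _ * A _ _); apply: val_inj.
Qed.

(* For a 2 x 2 matrix the entries of the adjugate are those of [A] up to sign,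
   so [|A| |A^-1| <= C] bounds the squares of the entries by [C |det A|]. *)
Lemma cond_number_entry (A : 'M[R[i]]_2) C i j : A \in unitmx -> cond_number A <= C ->
  normc (A i j) ^+ 2 <= C * normc (\det A).
Proof.
move=> uA cA.
have [i' [j' e]] : exists i' j', normc (A i j) = normc (\det A) * normc (invmx A i' j').
  have adj i' j' : \adj A i' j' = \det A * invmx A i' j'.
    have -> : invmx A = (\det A)^-1 *: \adj A by rewrite /invmx uA.
    rewrite [in RHS]mxE mulrA divff ?mul1r //.
  have co i0 j0 : \adj A i0 j0 = cofactor A j0 i0 by rewrite mxE.
  have nn (x : R[i]) : normc (- x) = normc x by rewrite normcN.
  (* On two indices [rev_ord] is the swap, and deleting one row and one column leaves the entry at
     the swapped position. *)
  exists (rev_ord j), (rev_ord i).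
  rewrite -Normc.normcM -adj co /cofactor det_mx11 !mxE Normc.normcM.
  have -> : normc ((-1) ^+ (rev_ord i + rev_ord j)) = 1.
    by elim: (_ + _)%N => [|p IH]; rewrite ?expr0 ?Normc.normc1 // exprS mulN1r nn.
  rewrite mul1r; congr (normc (A _ _)).
    by case: i => [[|[|//]]] hi; apply: val_inj.
  by case: j => [[|[|//]]] hj; apply: val_inj.
have -> : normc (A i j) ^+ 2 = normc (A i j) * normc (invmx A i' j') * normc (\det A).
  by rewrite expr2 {1}e; ring.
apply: ler_wpM2r; first exact: normc_ge0.
by apply: le_trans cA; apply: ler_pM; rewrite ?normc_ge0 ?entry_le_opnorm.
Qed.

End OperatorNorm.

(** * Green function and Born series *)

Section GreenAmplitudes.
Variables (R : realType) (a : R).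
Hypothesis a_gt0 : 0 < a.
Implicit Types (x y z : 'cV[R]_3) (k t : R) (u : R * R).
Local Notation normc := (@Normc.normc R).

Lemma cisD s t : cis (s + t) = cis s * cis t :> R[i].
Proof. by rewrite /cis cosD sinD; simpc; rewrite [X in _ +i* X]addrC. Qed.

Lemma cis0 : cis (0 : R) = 1.
Proof. by rewrite /cis cos0 sin0. Qed.

Lemma conj_cis t : Num.conj (cis t) = cis (- t) :> R[i].
Proof. by rewrite /cis cosN sinN. Qed.

Lemma normc_cis t : normc (cis t) = 1.
Proof. by rewrite /cis /= cos2Dsin2 sqrtr1. Qed.

Lemma cis_neq0 t : cis t != 0 :> R[i].
Proof.
by apply/eqP => e; have := normc_cis t; rewrite e Normc.normc0 => /esym/eqP; rewrite oner_eq0.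
Qed.

Lemma cisV t : (cis t)^-1 = cis (- t) :> R[i].
Proof.
by apply: (mulfI (cis_neq0 t)); rewrite divff ?cis_neq0 // -cisD subrr cis0.
Qed.

(** A polynomial in [t^-1], hence an amplitude whenever the inverse distance is one. The identity
    extends to [t = 0] because the inverse of 0 is 0. *)
Lemma green_mE t : green_m t = (- t^-1 ^+ 2) +i* t^-1.
Proof.
rewrite /green_m; have [->|t0] := eqVneq t 0.
  by rewrite expr0n /= rmorph0 !invr0 mulr0 expr0n /= oppr0.
by rewrite -fmorphV; simpc; rewrite -exprVn; congr (_ +i* _); field.
Qed.

Definition green_amp (x : 'cV[R]_3) y k : 'M[R[i]]_3 :=
  let m := green_m (k * enorm (x - y)) in
  ((4 * pi * enorm (x - y))^-1)%:C *: ((1 + m)%:M -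
    ((1 + 3 * m) / (enorm (x - y) ^+ 2)%:C) *: map_mx (real_complex R) ((x - y) *m (x - y)^T)).

Lemma Green_cis x y k : Green x y k = cis (k * enorm (x - y)) *: green_amp x y k.
Proof. by rewrite /Green /green_amp /Green0 scalerA -fmorphV. Qed.

(** A phase that depends on [k] alone is constant on the array, so its oscillation costs nothing in
    the Lipschitz bound. *)
Lemma complex_amp_cis_cst (r : R) : complex_amp a (fun k _ => cis (k * r)).
Proof.
split; apply: (@real_amp_bounded _ _ _ 1 0) => k _ /=; [exact: cos_max|exact: sin_max].
Qed.

Lemma real_amp_kV : real_amp a (fun k _ => k^-1).
Proof.
apply: (@real_amp_bounded _ _ _ 1 1) => k k1.
have k0 : 0 < k by exact: lt_le_trans k1.
by rewrite gtr0_norm ?invr_gt0 // invf_le1.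
Qed.

Lemma complex_amp_green_m (r : R -> R * R -> R) : real_amp a (fun k u => (r k u)^-1) ->
  complex_amp a (fun k u => green_m (k * r k u)).
Proof.
move=> hr; have ht : real_amp a (fun k u => (k * r k u)^-1).
  by apply: eq_real_amp (real_ampM real_amp_kV hr) => k u; rewrite invfM.
split.
  by apply: eq_real_amp (real_ampN (real_ampM ht ht)) => k u; rewrite green_mE /= expr2.
by apply: eq_real_amp ht => k u; rewrite green_mE.
Qed.

(** Both endpoints may move, so that one statement covers propagation to the array and propagation
    between fixed points. *)
Lemma matrix_amp_green_amp (x y : R -> R * R -> 'cV[R]_3) :
    real_amp a (fun k u => (enorm (x k u - y k u))^-1) ->
    (forall i, real_amp a (fun k u => (x k u - y k u) i 0)) ->
  matrix_amp a (fun k u => green_amp (x k u) (y k u) k).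
Proof.
move=> hr hd; have hm := complex_amp_green_m hr.
have h1 : complex_amp a (fun k u => 1 + green_m (k * enorm (x k u - y k u))).
  by apply: complex_ampD => //; exact: complex_amp_cst.
have h3 : complex_amp a (fun k u => 1 + 3 * green_m (k * enorm (x k u - y k u))).
  by apply: complex_ampD; [exact: complex_amp_cst|apply: complex_ampM => //; exact: complex_amp_cst].
apply: matrix_ampZ.
  apply: complex_amp_real.
  by apply: eq_real_amp (real_ampM (real_amp_cst a (4 * pi)^-1) hr) => k u; rewrite [in RHS]invfM.
apply: matrix_ampD.
  move=> i j; apply: (@eq_complex_amp _ _ (fun k u => (1 + green_m (k * enorm (x k u - y k u))) * (i == j)%:R)).
    by move=> k u; rewrite mxE mulr_natr.
  by apply: complex_ampM => //; exact: complex_amp_cst.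
apply: matrix_ampN; apply: matrix_ampZ.
  apply: (@eq_complex_amp _ _ (fun k u => (1 + 3 * green_m (k * enorm (x k u - y k u))) *
     ((enorm (x k u - y k u))^-1 * (enorm (x k u - y k u))^-1)%:C)).
    by move=> k u; rewrite -invfM -expr2 -fmorphV.
  by apply: complex_ampM => //; apply: complex_amp_real; exact: real_ampM.
move=> i j; apply: (@eq_complex_amp _ _ (fun k u => ((x k u - y k u) i 0 * (x k u - y k u) j 0)%:C)).
  by move=> k u; rewrite !mxE big_ord1 !mxE.
by apply: complex_amp_real; apply: real_ampM.
Qed.

Lemma real_amp_array_point z i : real_amp a (fun _ u => (array_point u - z) i 0).
Proof.
case: i => [[|[|[|//]]]] hi.
- by apply: eq_real_amp (real_ampD (real_amp_fst a) (real_amp_cst a (- z (Ordinal hi) 0))) => k u; rewrite !mxE.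
- by apply: eq_real_amp (real_ampD (real_amp_snd a) (real_amp_cst a (- z (Ordinal hi) 0))) => k u; rewrite !mxE.
- by apply: eq_real_amp (real_ampD (real_amp_cst a 0) (real_amp_cst a (- z (Ordinal hi) 0))) => k u; rewrite !mxE.
Qed.

Lemma matrix_amp_green_array z : x3 z != 0 ->
  matrix_amp a (fun k u => green_amp (array_point u) z k).
Proof.
move=> z0; apply: (@matrix_amp_green_amp (fun _ u => array_point u) (fun _ _ => z)).
  exact: real_amp_array_distV.
exact: real_amp_array_point.
Qed.

(** Between fixed points the whole Green function, phase included, counts as an amplitude.
    Coinciding points are allowed, thanks to the value 0 on the diagonal. *)
Lemma matrix_amp_Green_cst x y : matrix_amp a (fun k _ => Green x y k).
Proof.
have h : matrix_amp a (fun k _ => green_amp x y k).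
  by apply: (@matrix_amp_green_amp (fun _ _ => x) (fun _ _ => y)) => [|i]; exact: real_amp_cst.
move=> i j; apply: (@eq_complex_amp _ _ (fun k _ => cis (k * enorm (x - y)) * green_amp x y k i j)).
  by move=> k u; rewrite Green_cis [RHS]mxE.
by apply: complex_ampM; [exact: complex_amp_cis_cst|exact: h].
Qed.

Section BornSeries.
Variables (N : nat) (ys : 'I_N -> 'cV[R]_3) (alpha : 'I_N -> 'M[R[i]]_3) (xs : 'cV[R]_3).

(* All the dependence on the receiver is in the Green function from the last
   scatterer; the remaining factors oscillate in [k] but stay bounded. *)
Definition last_scattering (Pi : mxfield R 3 3) := exists B : 'I_N -> R -> 'M[R[i]]_3,
  (forall n, matrix_amp a (fun k _ => B n k)) /\
  forall x k, Pi x xs k = \sum_n Green x (ys n) k *m B n k.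

Lemma last_scattering0 : last_scattering (fun _ _ _ => 0).
Proof.
exists (fun _ _ => 0); split=> [n|x k]; first exact: matrix_amp_cst.
by rewrite big1 // => n _; rewrite mulmx0.
Qed.

Lemma last_scattering_sum I (r : seq I) (P : pred I) (F : I -> mxfield R 3 3) :
  (forall i, P i -> last_scattering (F i)) ->
  last_scattering (fun x x' k => \sum_(i <- r | P i) F i x x' k).
Proof.
move=> hF; elim: r => [|i r [B1 [hB1 e1]]].
  have [B [hB e]] := last_scattering0; exists B; split=> // x k.
  by rewrite big_nil -(e x k).
case Pi : (P i); last first.
  by exists B1; split=> // x k; rewrite big_cons Pi.
have [B2 [hB2 e2]] := hF _ Pi.
exists (fun n k => B2 n k + B1 n k); split=> [n|x k]; first exact: matrix_ampD.
rewrite big_cons Pi e2 e1 -big_split; apply: eq_bigr => n _ /=.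
by rewrite mulmxDr.
Qed.

Lemma matrix_amp_scattering_path x s : matrix_amp a (fun k _ => scattering_path ys alpha xs k x s).
Proof.
elim: s x => [|n s IH] x /=; first exact: matrix_amp_Green_cst.
apply: matrix_ampM (IH _); apply: matrix_ampM; first exact: matrix_amp_Green_cst.
exact: matrix_amp_cst.
Qed.

Lemma last_scattering_born_term j : (0 < j)%N -> last_scattering (born_term ys alpha j).
Proof.
case: j => // j _.
pose F (s : j.+1.-tuple 'I_N) : mxfield R 3 3 :=
  fun x x' k => scattering_path ys alpha x' k x s.
apply: (@last_scattering_sum _ _ _ F) => s _; rewrite /F /= {F}.
case: s => [[//|n s] /= _].
(* The head of the sequence is the scatterer next to the receiver, so a single path contributes to
   that index only. *)
exists (fun n' k => if n' == n then alpha n *m scattering_path ys alpha xs k (ys n) s else 0).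
split=> [n'|x k].
  case: (n' == n); last exact: matrix_amp_cst.
  by apply: matrix_ampM; [exact: matrix_amp_cst|exact: matrix_amp_scattering_path].
rewrite (bigD1 n) //= eqxx big1 ?addr0 ?mulmxA // => i /negPf ->.
by rewrite mulmx0.
Qed.

Lemma last_scattering_born_sum J : last_scattering (born_sum ys alpha J).
Proof.
rewrite /born_sum; have h i : (1 <= i < J.+1)%N -> last_scattering (born_term ys alpha i).
  by move=> /andP[i0 _]; exact: last_scattering_born_term.
have [B [hB e]] := @last_scattering_sum _ (index_iota 1 J.+1) (fun i => (0 < i)%N)
  (fun i => born_term ys alpha i) (fun i => @last_scattering_born_term i).
exists B; split=> // x k; rewrite -e [in RHS]big_mkcond; apply: eq_big_nat => i /andP[-> _] //.
Qed.

End BornSeries.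
End GreenAmplitudes.

(** * Invertibility of the direct field *)

Section SmallSums.

Lemma sum_ord3 (V : nmodType) (F : 'I_3 -> V) : \sum_i F i = F 0 + F 1 + F ord_max.
Proof.
rewrite big_ord_recl big_ord_recl big_ord1 addrA.
by congr (_ + F _ + F _); apply: val_inj.
Qed.

Lemma sum_ord2 (V : nmodType) (F : 'I_2 -> V) : \sum_i F i = F 0 + F 1.
Proof. by rewrite big_ord_recl big_ord1; congr (_ + F _); apply: val_inj. Qed.

Lemma ord2_cases (P : 'I_2 -> Prop) : P 0 -> P 1 -> forall i, P i.
Proof.
move=> P0 P1 [[|[|//]] hi].
- by rewrite (_ : Ordinal hi = 0) //; apply: val_inj.
- by rewrite (_ : Ordinal hi = 1) //; apply: val_inj.
Qed.

Definition plane_index (i : 'I_2) : 'I_3 := widen_ord (isT : (2 <= 3)%N) i.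

Lemma plane_index0 : plane_index 0 = 0. Proof. exact: val_inj. Qed.
Lemma plane_index1 : plane_index 1 = 1. Proof. exact: val_inj. Qed.

Lemma Upar_tr_mul (S : nzRingType) n (X : 'M[S]_(3, n)) i j : (Upar^T *m X) i j = X (plane_index i) j.
Proof.
rewrite mxE (bigD1 (plane_index i)) //= !mxE /= eqxx ltn_ord /= mul1r big1 ?addr0 // => k ki.
rewrite !mxE (_ : (_ == _) = false) ?mul0r //.
by apply/negbTE; apply: contra ki => /eqP e; apply/eqP/val_inj.
Qed.

End SmallSums.

Section Projection.
Variable R : realType.
Local Notation normc := (@Normc.normc R).
Variables (d : 'cV[R]_3) (Us : 'M[R]_(3, 2)).
Hypothesis Us_basis : orthonormal_basis_perp d Us.

(** The vector is [d] normalized. The square matrix with blocks [Us] and [n] has orthonormal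
    columns, and a left inverse of a square matrix is also a right inverse, which gives the
    completeness relation. *)
Lemma orthonormal_completion : exists n : 'cV[R]_3, n^T *m n = 1%:M /\ Us *m Us^T + n *m n^T = 1%:M.
Proof.
have [orth /andP[sub1 sub2]] := Us_basis.
have Ud : Us^T *m d = 0 by apply/sub_kermxP.
have d0 : d != 0.
  (* The kernel of the zero column would have rank 3, but it is spanned by two rows. *)
  apply/eqP => d0; have : ((1%:M : 'M[R]_3) <= Us^T)%MS.
    by apply: submx_trans sub2; rewrite d0 kermx0 submx1.
  by move/mxrankS; rewrite mxrank1 => h; have := leq_trans h (rank_leq_row _).
pose q := \sum_i (d i 0) ^+ 2.
have dd : d^T *m d = q%:M.
  apply/matrixP => i j; rewrite !ord1 !mxE eqxx mulr1n; apply: eq_bigr => k _.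
  by rewrite mxE expr2.
have q0 : 0 < q.
  rewrite lt_neqAle sumr_ge0 ?andbT => [|i _]; last exact: sqr_ge0.
  rewrite eq_sym; apply: contra d0 => /eqP s0; apply/eqP/matrixP => i j; rewrite ord1 mxE.
  have := psumr_eq0P (fun i _ => sqr_ge0 (d i 0)) s0 => /(_ i isT)/eqP.
  by rewrite sqrf_eq0 => /eqP.
have s2 : (Num.sqrt q)^-1 * (Num.sqrt q)^-1 * q = 1.
  by rewrite -invfM -expr2 sqr_sqrtr ?ltW // mulVf ?gt_eqF.
exists ((Num.sqrt q)^-1 *: d).
have nn : ((Num.sqrt q)^-1 *: d)^T *m ((Num.sqrt q)^-1 *: d) = 1%:M.
  by rewrite [X in X *m _]linearZ /= -scalemxAl -scalemxAr dd scalerA scale_scalar_mx s2.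
split=> //; set n := _ *: d in nn *.
have Un : Us^T *m n = 0 by rewrite -scalemxAr Ud scaler0.
have nU : n^T *m Us = 0 by rewrite -[Us]trmxK -trmx_mul Un trmx0.
have OO : (row_mx Us n)^T *m row_mx Us n = (1%:M : 'M[R]_(2 + 1, 2 + 1)).
  by rewrite tr_row_mx mul_col_row orth Un nU nn -scalar_mx_block.
by rewrite -mul_row_col -tr_row_mx; exact: mulmx1C OO.
Qed.

Section Unit.
Variables (w n : 'cV[R]_3).
Hypothesis ww : \sum_i w i 0 ^+ 2 = 1.
Hypothesis nn : Us *m Us^T + n *m n^T = 1%:M.

Let wn := \sum_i w i 0 * n i 0.
Let wu j := \sum_i w i 0 * Us i j.

(** The first two rows of [(I - w w^T) Us], which is the high-frequency limit of the direct field
    once its phase and its factor [1 / (4 pi r)] are removed. *)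
Definition proj_mx2 : 'M[R]_2 := \matrix_(i, j) (Us (plane_index i) j - wu j * w (plane_index i) 0).

Let compl i j : Us i 0 * Us j 0 + Us i 1 * Us j 1 + n i 0 * n j 0 = (i == j)%:R.
Proof.
have /matrixP/(_ i j) := nn; rewrite !mxE big_ord1 sum_ord2 !mxE => <- //.
Qed.

Let compl1 i : Us i 0 * Us i 0 + Us i 1 * Us i 1 + n i 0 * n i 0 = 1.
Proof. by rewrite compl eqxx. Qed.

Let wuE i : wu 0 * Us i 0 + wu 1 * Us i 1 + wn * n i 0 = w i 0.
Proof.
rewrite /wu /wn !mulr_suml -!big_split /= (bigD1 i) //= big1 => [|j ji].
  have c := compl1 i; rewrite addr0 -[RHS]mulr1 -c; ring.
have := compl j i; rewrite (negPf ji) => c.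
by rewrite -!mulrA -!mulrDr c mulr0.
Qed.

Let wsq : wu 0 ^+ 2 + wu 1 ^+ 2 + wn ^+ 2 = 1.
Proof.
have e j : wu j ^+ 2 = \sum_i w i 0 * (wu j * Us i j).
  by rewrite expr2 {1}/wu mulr_suml; apply: eq_bigr => i _; ring.
have e' : wn ^+ 2 = \sum_i w i 0 * (wn * n i 0).
  by rewrite expr2 {1}/wn mulr_suml; apply: eq_bigr => i _; ring.
rewrite !e e' -!big_split /= -ww; apply: eq_bigr => i _.
by rewrite -!mulrDr wuE expr2.
Qed.

Let row_sq i : (Us i 0 - wu 0 * w i 0) ^+ 2 + (Us i 1 - wu 1 * w i 0) ^+ 2 =
  1 - w i 0 ^+ 2 - (n i 0 - wn * w i 0) ^+ 2.
Proof.
have c := compl1 i; have e := wuE i; have s := wsq.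
have -> : (Us i 0 - wu 0 * w i 0) ^+ 2 + (Us i 1 - wu 1 * w i 0) ^+ 2 =
  (Us i 0 * Us i 0 + Us i 1 * Us i 1 + n i 0 * n i 0) - n i 0 ^+ 2 -
  2 * w i 0 * (wu 0 * Us i 0 + wu 1 * Us i 1 + wn * n i 0) + 2 * w i 0 * wn * n i 0 +
  w i 0 ^+ 2 * (wu 0 ^+ 2 + wu 1 ^+ 2 + wn ^+ 2) - w i 0 ^+ 2 * wn ^+ 2 by ring.
by rewrite c e s; ring.
Qed.

(** Written as a sum of squares, the Frobenius norm serves twice: it is at least the squared third
    component of [w], and it vanishes only if [w] is horizontal and orthogonal to [n] and [n] is
    horizontal. *)
Lemma proj_mx2_sq : \sum_i \sum_j proj_mx2 i j ^+ 2 =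
  wn ^+ 2 + x3 w ^+ 2 + (x3 n - wn * x3 w) ^+ 2.
Proof.
have n1 : \sum_i n i 0 ^+ 2 = 1.
  have t : \sum_i (Us i 0 ^+ 2 + Us i 1 ^+ 2 + n i 0 ^+ 2) = 3.
    by under eq_bigr => i _ do rewrite !expr2 compl1; rewrite sumr_const card_ord.
  have [orth _] := Us_basis.
  have o j : \sum_i Us i j ^+ 2 = 1.
    have /matrixP/(_ j j) := orth; rewrite !mxE eqxx mulr1n => <-.
    by apply: eq_bigr => i _; rewrite mxE expr2.
  by move: t; rewrite !big_split /= !o; lra.
rewrite sum_ord2 !sum_ord2 !mxE plane_index0 plane_index1 !row_sq.
move: ww n1 (erefl wn); rewrite {2}/wn !sum_ord3 -/(x3 w) -/(x3 n) => w1 n1 e.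
have -> : w 0 0 ^+ 2 = 1 - w 1 0 ^+ 2 - x3 w ^+ 2 by rewrite -w1; ring.
have h : (n 0 0 - wn * w 0 0) ^+ 2 + (n 1 0 - wn * w 1 0) ^+ 2 + (x3 n - wn * x3 w) ^+ 2
   = 1 - wn ^+ 2.
  transitivity ((n 0 0 ^+ 2 + n 1 0 ^+ 2 + x3 n ^+ 2) -
    2 * wn * (w 0 0 * n 0 0 + w 1 0 * n 1 0 + x3 w * x3 n) +
    wn ^+ 2 * (w 0 0 ^+ 2 + w 1 0 ^+ 2 + x3 w ^+ 2)); first by ring.
  by rewrite n1 -e w1; ring.
lra.
Qed.

(** For horizontal [w] the matrix factors through the planar projection orthogonal to [w], whose
    determinant is [1 - |w|^2]. *)
Lemma proj_mx2_det0 : x3 w = 0 -> \det proj_mx2 = 0.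
Proof.
move=> w3; rewrite det_mx22 !mxE plane_index0 plane_index1.
move: ww; rewrite /wu !sum_ord3 -/(x3 w) w3 => w1.
transitivity ((Us 0 0 * Us 1 1 - Us 1 0 * Us 0 1) * (1 - (w 0 0 ^+ 2 + w 1 0 ^+ 2 + 0 ^+ 2))).
  by ring.
by rewrite w1 subrr mulr0.
Qed.

Lemma proj_entries_le1 i j : `|Us (plane_index i) j| <= 1 /\ `|wu j * w (plane_index i) 0| <= 1.
Proof.
have sq1 (x y z : R) : x ^+ 2 + y ^+ 2 + z ^+ 2 = 1 -> `|x| <= 1 /\ `|y| <= 1.
  move=> e; have := sqr_ge0 x; have := sqr_ge0 y; have := sqr_ge0 z => *.
  by split; rewrite -(@expr_le1 _ 2) ?normr_ge0 // real_normK ?num_real //; lra.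
have [U0 U1] : `|Us (plane_index i) 0| <= 1 /\ `|Us (plane_index i) 1| <= 1.
  by apply: (sq1 _ _ (n (plane_index i) 0)); rewrite !expr2 compl1.
have [W0 W1] := sq1 _ _ _ wsq.
have w1 : `|w (plane_index i) 0| <= 1.
  have := ww; rewrite sum_ord3 => /sq1[w0 w1].
  by move: i {U0 U1}; apply: ord2_cases; rewrite ?plane_index0 ?plane_index1.
have Wj : `|wu j| <= 1 by move: j; apply: ord2_cases.
split; first by move: j {Wj}; apply: ord2_cases.
by rewrite normrM mulr_ile1.
Qed.

End Unit.
End Projection.

Section DetBound.
Variables (R : realType) (a : R) (xs d : 'cV[R]_3) (Us : 'M[R]_(3, 2)).
Hypothesis a_gt0 : 0 < a.
Hypothesis Us_basis : orthonormal_basis_perp d Us.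
Hypothesis G_cond : well_conditioned Us a xs.
Local Notation normc := (@Normc.normc R).
Implicit Types (u : R * R) (k : R).

Definition tilde_amp k u : 'M[R[i]]_2 :=
  Upar^t* *m green_amp (array_point u) xs k *m map_mx (real_complex R) Us.

Lemma tilde_Green_cis k u :
  tilde Us (@Green R) (array_point u) xs k = cis (k * array_dist xs u) *: tilde_amp k u.
Proof. by rewrite /tilde Green_cis -scalemxAr -scalemxAl. Qed.

Lemma Upar_adj : (Upar : 'M[R[i]]_(3, 2)) ^t* = Upar^T.
Proof.
apply/matrixP => i j; rewrite !mxE; case: (_ && _); [exact: rmorph1|exact: rmorph0].
Qed.

Definition dir u : 'cV[R]_3 := (array_dist xs u)^-1 *: (array_point u - xs).

(** The first two rows of [(I - 3 w w^T) Us] with [w = dir u]: the coefficient of [m(kr)] in the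
    direct field, that is, its near-field correction. *)
Definition pert_mx u : 'M[R]_2 :=
  \matrix_(i, j) (Us (plane_index i) j - 3 * ((\sum_i' dir u i' 0 * Us i' j) * dir u (plane_index i) 0)).

Lemma array_dist_sqr u : array_dist xs u ^+ 2 = \sum_i (array_point u - xs) i 0 ^+ 2.
Proof. by rewrite sqr_sqrtr // sumr_ge0 // => i _; rewrite sqr_ge0. Qed.

Lemma dir_sqr u : 0 < array_dist xs u -> \sum_i dir u i 0 ^+ 2 = 1.
Proof.
move=> r0; under eq_bigr do rewrite mxE exprMn.
by rewrite -mulr_sumr -array_dist_sqr -exprMn mulVf ?expr1n // gt_eqF.
Qed.

Lemma tilde_amp_entry k u i j : 0 < array_dist xs u ->
  tilde_amp k u i j = ((4 * pi * array_dist xs u)^-1)%:C *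
    ((proj_mx2 Us (dir u) i j)%:C + green_m (k * array_dist xs u) * (pert_mx u i j)%:C).
Proof.
move=> r0; rewrite /tilde_amp Upar_adj -mulmxA Upar_tr_mul /green_amp -/(array_dist xs u).
set m := green_m _; set c := (_^-1)%:C; set dd := array_point u - xs.
rewrite -scalemxAl mulmxBl mul_scalar_mx -scalemxAl -map_mxM.
have entry (x y z : R[i]) (X Y : 'M[R[i]]_(3, 2)) i' :
    (x *: (y *: X - z *: Y)) i' j = x * (y * X i' j - z * Y i' j) by rewrite !mxE.
rewrite entry !(mxE _ (fun i j => real_complex R _)) ; rewrite -/dd.
have -> : (dd *m dd^T *m Us) (plane_index i) j = array_dist xs u ^+ 2 *
   ((\sum_i' dir u i' 0 * Us i' j) * dir u (plane_index i) 0).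
  rewrite -mulmxA mxE big_ord1 !mxE mulr_suml mulr_sumr mulr_sumr.
  by apply: eq_bigr => l _; rewrite !mxE; field; rewrite gt_eqF.
rewrite [proj_mx2 Us (dir u) i j]mxE [pert_mx u i j]mxE.
set q := (\sum_i' _) * _; rewrite !rmorphB !rmorphM rmorph_nat /=.
have r2 : ((array_dist xs u)%:C : R[i]) != 0 by rewrite fmorph_eq0 gt_eqF.
by clearbody c m q; field.
Qed.

Lemma normc_real (x : R) : normc x%:C = `|x|.
Proof. by rewrite /= expr0n addr0 sqrtr_sqr. Qed.

Lemma normc_green_m (t : R) : 1 <= t -> normc (green_m t) <= 2 / t.
Proof.
move=> t1; have t0 : 0 < t by exact: lt_le_trans t1.
have ti : 0 < t^-1 <= 1 by rewrite invr_gt0 t0 invf_le1.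
have h0 : 0 <= 2 / t by rewrite divr_ge0 // ltW.
rewrite green_mE /= -[leRHS](ger0_norm h0) -sqrtr_sqr; apply: ler_wsqrtr.
rewrite sqrrN; move/andP: ti => [ti0 ti1].
have : 0 <= t^-1 ^+ 2 <= 1 by rewrite sqr_ge0 expr_le1 // ltW.
rewrite (_ : (2 / t) ^+ 2 = 4 * t^-1 ^+ 2); last by ring.
set y := t^-1 ^+ 2 => /andP[y0 y1]; nra.
Qed.

(** The constant 32 is [2 * 4 ^ 2], from the square of a sum and [|m|^2 <= |m|]. The constant 64
    adds 32 for the four mixed products in the determinant, each at most [2 * 4], and 32 for the two
    products of entries of [l]. *)
Lemma mx22_perturbation (h l : 'M[R]_2) (A : 'M[R[i]]_2) (m : R[i]) :
    (forall i j, `|h i j| <= 2) -> (forall i j, `|l i j| <= 4) ->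
    (forall i j, A i j = (h i j)%:C + m * (l i j)%:C) -> normc m <= 1 ->
  (forall i j, h i j ^+ 2 <= 2 * normc (A i j) ^+ 2 + 32 * normc m) /\
  normc (\det A - (\det h)%:C) <= 64 * normc m.
Proof.
move=> h2 l4 AE m1; have m0 := normc_ge0 m.
split=> [i j|].
  have : normc (h i j)%:C <= normc (A i j) + normc m * 4.
    have -> : (h i j)%:C = A i j + - (m * (l i j)%:C) by rewrite AE addrK.
    apply: le_trans (le_normcD _ _) _; rewrite lerD2l normcN Normc.normcM.
    by apply: ler_wpM2l => //; rewrite normc_real.
  rewrite normc_real => hA.
  have := normc_ge0 (A i j); rewrite -(real_normK (num_real (h i j))).
  have s1 : `|h i j| ^+ 2 <= (normc (A i j) + normc m * 4) ^+ 2.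
    by rewrite ler_sqr ?nnegrE // addr_ge0 ?mulr_ge0 ?normc_ge0.
  have s2 := sqr_ge0 (normc (A i j) - normc m * 4).
  have s3 : normc m ^+ 2 <= normc m by rewrite expr2 ler_piMl.
  by move=> _; apply: le_trans s1 _; move: s2 s3; nra.
rewrite !det_mx22 !AE.
pose X := h 0 0 * l 1 1 + l 0 0 * h 1 1 - h 0 1 * l 1 0 - l 0 1 * h 1 0.
pose Y := l 0 0 * l 1 1 - l 0 1 * l 1 0.
have -> : ((h 0 0)%:C + m * (l 0 0)%:C) * ((h 1 1)%:C + m * (l 1 1)%:C) -
  ((h 0 1)%:C + m * (l 0 1)%:C) * ((h 1 0)%:C + m * (l 1 0)%:C) -
  (h 0 0 * h 1 1 - h 0 1 * h 1 0)%:C = m * X%:C + m * m * Y%:C.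
  by rewrite /X /Y !(rmorphB, rmorphD, rmorphM) /=; ring.
have pr (x y b c : R) : `|x| <= b -> `|y| <= c -> `|x * y| <= b * c.
  by move=> ? ?; rewrite normrM; apply: ler_pM.
have X32 : `|X| <= 32.
  have := pr _ _ _ _ (h2 0 0) (l4 1 1); have := pr _ _ _ _ (l4 0 0) (h2 1 1).
  have := pr _ _ _ _ (h2 0 1) (l4 1 0); have := pr _ _ _ _ (l4 0 1) (h2 1 0).
  by rewrite /X !ler_norml; lra.
have Y32 : `|Y| <= 32.
  have := pr _ _ _ _ (l4 0 0) (l4 1 1); have := pr _ _ _ _ (l4 0 1) (l4 1 0).
  by rewrite /Y !ler_norml; lra.
apply: le_trans (le_normcD _ _) _; rewrite !Normc.normcM !normc_real.
have : normc m * `|X| <= normc m * 32 by apply: ler_wpM2l.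
have : normc m * normc m * `|Y| <= normc m * 1 * 32.
  by apply: ler_pM => //; [exact: mulr_ge0|apply: ler_wpM2l].
lra.
Qed.

Lemma proj_pert_bounds u : 0 < array_dist xs u ->
  (forall i j, `|proj_mx2 Us (dir u) i j| <= 2) /\ (forall i j, `|pert_mx u i j| <= 4).
Proof.
move=> r0; have [n [_ nn]] := orthonormal_completion Us_basis.
have b := proj_entries_le1 (dir_sqr r0) nn.
split=> i j; have [b1 b2] := b i j; rewrite mxE; apply: le_trans (ler_normB _ _) _.
  by move: b1 b2; lra.
by rewrite normrM (ger0_norm (_ : 0 <= 3)) //; move: b1 b2; lra.
Qed.

Lemma entry_le_det : exists C K, 0 < C /\ forall k u, K <= k -> array a u ->
  0 < array_dist xs u /\ forall i j, normc (tilde_amp k u i j) ^+ 2 <= C * normc (\det (tilde_amp k u)).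
Proof.
have [C [K h]] := G_cond; exists (`|C| + 1), K; split=> [|k u Kk ua]; first by rewrite ltr_wpDl.
have [uG cG] := h k u Kk ua.
have r0 : 0 < array_dist xs u.
  (* At distance 0 the Green function is 0 by convention, so the direct field could not be
     invertible. *)
  rewrite lt_neqAle [_ <= _]sqrtr_ge0 andbT; apply/eqP => r0.
  move: uG; rewrite tilde_Green_cis /tilde_amp /green_amp -/(array_dist xs u) -r0 !mulr0 invr0.
  rewrite scale0r mulmx0 mul0mx scaler0 unitmxE det_mx22 !mxE mulr0 subrr.
  by rewrite unitfE eqxx.
split=> // i j; have := cond_number_entry i j uG cG.
rewrite tilde_Green_cis detZ mxE [cis _ ^+ 2]expr2 !Normc.normcM !normc_cis !mul1r => e.
apply: le_trans e _.
apply: ler_wpM2r; first exact: normc_ge0.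
by have := ler_norm C; lra.
Qed.

Definition pert_tilde_amp k u : 'M[R[i]]_2 :=
  \matrix_(i, j) ((proj_mx2 Us (dir u) i j)%:C + green_m (k * array_dist xs u) * (pert_mx u i j)%:C).

Lemma tilde_ampE k u : 0 < array_dist xs u ->
  tilde_amp k u = ((4 * pi * array_dist xs u)^-1)%:C *: pert_tilde_amp k u.
Proof.
move=> r0; apply/matrixP => i j.
by rewrite (tilde_amp_entry k i j r0) [RHS]mxE [pert_tilde_amp k u i j]mxE.
Qed.

Lemma pert_tilde_amp_bounds k u : 0 < array_dist xs u -> 1 <= k * array_dist xs u ->
  let e := 2 / (k * array_dist xs u) in
  (e <= 1 -> forall i j, proj_mx2 Us (dir u) i j ^+ 2 <= 2 * normc (pert_tilde_amp k u i j) ^+ 2 + 32 * e) /\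
  (e <= 1 -> `|normc (\det (pert_tilde_amp k u)) - `|\det (proj_mx2 Us (dir u))| | <= 64 * e).
Proof.
move=> r0 kr1 e; have [h2 l4] := proj_pert_bounds r0.
have me : normc (green_m (k * array_dist xs u)) <= e by exact: normc_green_m.
have E i j : pert_tilde_amp k u i j = (proj_mx2 Us (dir u) i j)%:C +
    green_m (k * array_dist xs u) * (pert_mx u i j)%:C by rewrite [LHS]mxE.
split=> e1; have [p1 p2] := mx22_perturbation h2 l4 E (le_trans me e1).
  by move=> i j; apply: le_trans (p1 i j) _; rewrite lerD2l ler_wpM2l.
have p3 : normc (\det (pert_tilde_amp k u) - (\det (proj_mx2 Us (dir u)))%:C) <= 64 * e.
  by apply: le_trans p2 _; rewrite ler_wpM2l.
rewrite -[`|\det (proj_mx2 _ _)|]normc_real; apply: le_trans _ p3.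
set A := \det _; set B := _%:C.
have hA : normc A <= normc (A - B) + normc B by rewrite -{1}(subrK B A); exact: le_normcD.
have hB : normc B <= normc (A - B) + normc A.
  have eB : B = - (A - B) + A by rewrite opprB subrK.
  by rewrite [X in normc X <= _]eB; apply: le_trans (le_normcD _ _) _; rewrite normcN.
by rewrite ler_norml; lra.
Qed.

(* Letting [k] tend to infinity, the bound of the entries by the determinant
   passes to the transverse projection. *)
Lemma proj_le_det C K u : 0 < C -> 0 < array_dist xs u ->
    (forall k, K <= k -> forall i j, normc (tilde_amp k u i j) ^+ 2 <= C * normc (\det (tilde_amp k u))) ->
  forall i j, proj_mx2 Us (dir u) i j ^+ 2 <= 2 * C * `|\det (proj_mx2 Us (dir u))|.
Proof.
move=> C0 r0 hK i j; apply/ler_addgt0Pr => e e0.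
(* With [m] of size at most [2 / (k r)], the entry error 32 and the determinant error 64, weighted
   by [2 C], add up to [B / (k r)]. The choice of [k] makes this at most [e]. *)
set r := array_dist xs u in r0 *; pose B := 2 * (128 * C + 32).
have B0 : 0 < B by rewrite /B; lra.
pose k := Num.max K ((2 + B / e) / r).
have Kk : K <= k by rewrite le_max lexx.
have kr : 2 + B / e <= k * r by rewrite -ler_pdivrMr // le_max lexx orbT.
have Be0 : 0 < B / e by rewrite divr_gt0.
have kr1 : 1 <= k * r by lra.
have kr0 : 0 < k * r by lra.
have [b1 b2] := pert_tilde_amp_bounds r0 kr1; rewrite -/r in b1 b2.
have e1 : 2 / (k * r) <= 1 by rewrite ler_pdivrMr //; lra.
have {b1}h1 := b1 e1 i j; have {b2}h2 := b2 e1.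
have c0 : 0 < (4 * pi * r)^-1 by rewrite invr_gt0 !mulr_gt0 ?pi_gt0.
have h3 : normc (pert_tilde_amp k u i j) ^+ 2 <= C * normc (\det (pert_tilde_amp k u)).
  have := hK k Kk i j; rewrite tilde_ampE // detZ mxE !Normc.normcM !normc_real -/r gtr0_norm // -expr2 exprMn.
  by rewrite [leRHS]mulrCA ler_pM2l // exprn_gt0.
have h4 : normc (\det (pert_tilde_amp k u)) <= `|\det (proj_mx2 Us (dir u))| + 64 * (2 / (k * r)).
  by move: h2; rewrite ler_norml; lra.
have h5 : C * normc (\det (pert_tilde_amp k u)) <=
    C * (`|\det (proj_mx2 Us (dir u))| + 64 * (2 / (k * r))) by rewrite ler_pM2l.
have h6 : B * (1 / (k * r)) <= e.
  rewrite mul1r ler_pdivrMr // mulrC -ler_pdivrMr //.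
  by apply: le_trans kr; lra.
apply: le_trans h1 _; move: h3 h5 h6; rewrite /B mul1r.
set q := (k * r)^-1; set X := normc _ ^+ 2; set Y := normc (\det _).
by set Z := `| _ |; move: q X Y Z => q X Y Z; lra.
Qed.

Lemma array_center : array a (0, 0).
Proof. by apply/arrayP; rewrite /= oppr_le0 divr_ge0 // ltW. Qed.

(** For a source in the plane of the array every direction is horizontal, the limiting determinant
    is 0, and the limiting matrix vanishes with it. Then [n] is horizontal and orthogonal to
    [x - xs] for each array point [x]; the centre and two edge midpoints force [n = 0], although [n]
    is a unit vector. *)
Lemma source_off_plane : x3 xs != 0.
Proof.
have [C [K [C0 hK]]] := entry_le_det; apply/negP => /eqP x30.
have [n [nn1 nn]] := orthonormal_completion Us_basis.
have key u : array a u -> x3 n = 0 /\ \sum_i (array_point u - xs) i 0 * n i 0 = 0.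
  move=> ua; have [r0 _] := hK K u (lexx _) ua.
  have w3 : x3 (dir u) = 0.
    by rewrite /x3 !mxE /= -/(x3 xs) x30 subr0 mulr0.
  have det0 := proj_mx2_det0 Us (dir_sqr r0) w3.
  have z i j : proj_mx2 Us (dir u) i j = 0.
    have := @proj_le_det C K u C0 r0 (fun k Kk => (hK k u Kk ua).2) i j.
    rewrite det0 normr0 mulr0 => h; apply/eqP; rewrite -sqrf_eq0 eq_le h.
    by rewrite sqr_ge0.
  have := proj_mx2_sq Us_basis (dir_sqr r0) nn.
  rewrite w3 big1; last by move=> i _; rewrite big1 // => j _; rewrite z expr0n.
  set s := \sum_i _; rewrite mulr0 subr0 => e.
  have [s0 n0] : s = 0 /\ x3 n = 0.
    by have := sqr_ge0 s; have := sqr_ge0 (x3 n); split; apply/eqP; rewrite -sqrf_eq0; apply/eqP; lra.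
  split=> //; move: s0; rewrite /s /dir; under eq_bigr do rewrite mxE -mulrA.
  by rewrite -mulr_sumr => /eqP; rewrite mulf_eq0 invr_eq0 gt_eqF //= => /eqP.
have [n3 e0] := key _ array_center.
have [|_ e1] := key (a / 2, 0); first by apply/arrayP => /=; split; move: a_gt0; lra.
have [|_ e2] := key (0, a / 2); first by apply/arrayP => /=; split; move: a_gt0; lra.
move: e0 e1 e2; rewrite !sum_ord3 -/(x3 n) n3 !mxE /= => e0 e1 e2.
have a2 : a / 2 != 0 by rewrite gt_eqF // divr_gt0.
have n0 : n 0 0 = 0.
  by apply: (mulfI a2); rewrite mulr0; move: e0 e1 e2; lra.
have n1 : n 1 0 = 0.
  by apply: (mulfI a2); rewrite mulr0; move: e0 e1 e2; lra.
have /matrixP/(_ 0 0) := nn1; rewrite !mxE sum_ord3 !mxE -/(x3 n) n0 n1 n3.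
by move/eqP; rewrite !mulr0 !addr0 eq_sym oner_eq0.
Qed.

(** Off the plane, the vertical component of the direction is at least [|x3 xs| / M] on the array.
    Its square is bounded by the sum of four squared entries, each at most [2 C] times the limiting
    determinant, which gives the factor 8. Large [k] loses at most half of this bound. *)
Lemma tilde_amp_det_lower : exists c K, 0 < c /\ forall k u, K <= k -> array a u ->
  c <= complex.Re (\det (tilde_amp k u)) ^+ 2 + complex.Im (\det (tilde_amp k u)) ^+ 2.
Proof.
have [C [K [C0 hK]]] := entry_le_det; have x0 := source_off_plane.
have [_ [M [K' [M0 hM]]]] := real_amp_array_dist a xs.
have rM u : array a u -> array_dist xs u <= M.
  by move=> ua; have [+ _] := hM K' u (lexx _) ua; exact/le_trans/ler_norm.
have rx u : `|x3 xs| <= array_dist xs u := array_dist_ge xs u.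
have x0' : 0 < `|x3 xs| by rewrite normr_gt0.
have M_gt0 : 0 < M by apply: lt_le_trans x0' (le_trans (rx _) (rM _ array_center)).
pose D := (`|x3 xs| / M) ^+ 2; have D0 : 0 < D by rewrite exprn_gt0 // divr_gt0.
have r0 u : 0 < array_dist xs u by exact: lt_le_trans (rx u).
have det_ge u : array a u -> D <= 8 * C * `|\det (proj_mx2 Us (dir u))|.
  move=> ua; have [n [_ nn]] := orthonormal_completion Us_basis.
  have w3 : D <= x3 (dir u) ^+ 2.
    rewrite /x3 !mxE /= sub0r -/(x3 xs) mulrN sqrrN -[_ ^+ 2]real_normK ?num_real //.
    rewrite ler_sqr ?nnegrE ?divr_ge0 ?normr_ge0 // normrM normfV (gtr0_norm (r0 u)) mulrC.
    by rewrite ler_pM2r // lef_pV2 ?posrE // rM.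
  have e := proj_mx2_sq Us_basis (dir_sqr (r0 u)) nn; rewrite sum_ord2 !sum_ord2 in e.
  have b i j := @proj_le_det C K u C0 (r0 u) (fun k Kk => (hK k u Kk ua).2) i j.
  apply: le_trans w3 _; move: (b 0 0) (b 0 1) (b 1 0) (b 1 1) e.
  set s := \sum_i _; set y := x3 n - _.
  by have := sqr_ge0 s; have := sqr_ge0 y; lra.
pose E := D / (8 * C); have E0 : 0 < E by rewrite divr_gt0 // mulr_gt0.
have hE u : array a u -> E <= `|\det (proj_mx2 Us (dir u))|.
  by move=> ua; rewrite /E ler_pdivrMr ?mulr_gt0 // mulrC det_ge.
clearbody E; pose c := ((4 * pi * M)^-1) ^+ 2 * (E / 2).
have c0 : 0 < c.
  apply: mulr_gt0; last exact: divr_gt0.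
  by apply: exprn_gt0; rewrite invr_gt0 !mulr_gt0 ?pi_gt0.
(* The error [64 * 2 / (k r)] is at most [E / 2] as soon as [k r >= 256 / E]; the extra 2 keeps
   [2 / (k r)] below 1. *)
exists (c ^+ 2), (Num.max 0 ((2 + 256 / E) / `|x3 xs|)); split; first by rewrite exprn_gt0.
move=> k u; rewrite ge_max => /andP[k0 kK] ua.
have EE : 0 < 256 / E by rewrite divr_gt0.
have kr : 2 + 256 / E <= k * array_dist xs u.
  apply: le_trans (_ : k * `|x3 xs| <= _); first by rewrite -ler_pdivrMr.
  by rewrite ler_wpM2l.
have kr0 : 0 < k * array_dist xs u by lra.
have kr1 : 1 <= k * array_dist xs u by lra.
have e1 : 2 / (k * array_dist xs u) <= 1 by rewrite ler_pdivrMr //; lra.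
have h1 : 64 * (2 / (k * array_dist xs u)) <= E / 2.
  rewrite mulrA ler_pdivrMr // [leRHS]mulrC -ler_pdivrMr ?divr_gt0 //.
  by apply: le_trans kr; rewrite invf_div; lra.
have [_ /(_ e1)] := pert_tilde_amp_bounds (r0 u) kr1.
rewrite ler_norml => /andP[h2 _].
have h3 := hE u ua.
have h4 : E / 2 <= normc (\det (pert_tilde_amp k u)) by lra.
rewrite -normc_sqr ler_sqr ?nnegrE ?normc_ge0 ?(ltW c0) //.
rewrite (tilde_ampE k (r0 u)) detZ expr2 !Normc.normcM normc_real -expr2 gtr0_norm; last first.
  by rewrite invr_gt0 !mulr_gt0 ?pi_gt0.
have p0 : 0 < 4 * pi :> R by rewrite mulr_gt0 ?pi_gt0.
apply: ler_pM; [exact: sqr_ge0|by apply: divr_ge0 => //; exact: ltW| |exact: h4].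
have i0 (x : R) : 0 < x -> 0 <= (4 * pi * x)^-1.
  by move=> xp; rewrite invr_ge0; apply: mulr_ge0; exact: ltW.
rewrite ler_pXn2r ?nnegrE ?i0 ?M_gt0 ?r0 //.
have q0 (x : R) : 0 < x -> 0 < 4 * pi * x by move=> xp; exact: mulr_gt0.
by rewrite lef_pV2 ?posrE ?q0 ?r0 // ler_pM2l // rM.
Qed.

End DetBound.

(** * Error terms of the preprocessed data *)

(** [H] and [Q] stand for the adjoints of [G] and [P]; with them as independent matrices, no
    conjugation enters the computation. *)
Lemma data_split (F : fieldType) (G P J H Q : 'M[F]_2) : H \in unitmx -> J \in unitmx ->
  (G *m J *m H + P *m J *m H + G *m J *m Q + P *m J *m Q - G *m J *m H) *m invmx H *m invmx J =
  P + (G + P) *m J *m Q *m invmx H *m invmx J.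
Proof.
move=> uH uJ.
have -> : G *m J *m H + P *m J *m H + G *m J *m Q + P *m J *m Q - G *m J *m H =
    P *m J *m H + (G + P) *m J *m Q.
  by apply/eqP; rewrite subr_eq 2!mulmxDl [X in _ == X]addrC !addrA.
by rewrite 2!mulmxDl (mulmxK uH) (mulmxK uJ).
Qed.

Lemma mx_entryD (V : nmodType) m n (A B : 'M[V]_(m, n)) i j : (A + B) i j = A i j + B i j.
Proof. exact: mxE. Qed.

Lemma addIr_subr (V : zmodType) (x y z : V) : z = x + y -> y = z - x.
Proof. by move=> ->; rewrite addrC addKr. Qed.

Section Asymptotics.
Variable R : realType.
Local Notation normc := (@Normc.normc R).

Lemma normc_le_ReIm (x : R[i]) : normc x <= `|complex.Re x| + `|complex.Im x|.
Proof.
rewrite -ler_sqr ?nnegrE ?normc_ge0 ?addr_ge0 // normc_sqr sqrrD.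
rewrite !real_normK ?num_real // addrAC lerDl mulrn_wge0 // mulr_ge0 //.
Qed.

Lemma asymp_eq_entries m n (f g : R -> 'M[R[i]]_(m, n)) :
  (forall i j, vanishes (fun k => (f k - g k) i j)) -> asymp_eq f g.
Proof.
move=> h; apply/cvgr0Pnorm_le => e e0.
(* The 2 counts the real and imaginary parts of an entry, and the 1 keeps the divisor positive for
   empty matrices. *)
pose e' := e / (1 + \sum_(i < m) \sum_(j < n) 2).
have s0 : 0 <= \sum_(i < m) \sum_(j < n) 2 :> R by do 2 (apply: sumr_ge0 => ? _).
have e'0 : 0 < e' by rewrite divr_gt0 // ltr_wpDr.
have near_small : \forall k \near +oo, forall i j,
    `|complex.Re ((f k - g k) i j)| <= e' /\ `|complex.Im ((f k - g k) i j)| <= e'.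
  apply: filter_forall => i; apply: filter_forall => j.
  have [/cvgr0Pnorm_le/(_ e' e'0) h1 /cvgr0Pnorm_le/(_ e' e'0) h2] := h i j.
  by apply: filterS2 h1 h2 => k.
apply: filterS near_small => k hk; rewrite ger0_norm ?opnorm_ge0 //.
apply: le_trans (opnorm_le_sum _) _.
apply: le_trans (_ : \sum_(i < m) \sum_(j < n) e' * 2 <= _).
  apply: ler_sum => i _; apply: ler_sum => j _; have [h1 h2] := hk i j.
  by apply: le_trans (normc_le_ReIm _) _; lra.
under eq_bigr do rewrite -mulr_sumr.
rewrite -mulr_sumr /e' mulrAC ler_pdivrMr ?ltr_wpDr // ler_pM2l //.
by rewrite lerDr.
Qed.

Lemma mxconjZ m n c (A : 'M[R[i]]_(m, n)) : mxconj (c *: A) = Num.conj c *: mxconj A.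
Proof. exact: map_mxZ. Qed.

Lemma adjZ m n c (A : 'M[R[i]]_(m, n)) : (c *: A) ^t* = Num.conj c *: A ^t*.
Proof. by rewrite linearZ /= map_mxZ. Qed.

Lemma adj_sum m n I (r : seq I) (P : pred I) (A : I -> 'M[R[i]]_(m, n)) :
  (\sum_(i <- r | P i) A i) ^t* = \sum_(i <- r | P i) (A i) ^t*.
Proof. by rewrite !raddf_sum. Qed.

End Asymptotics.

Section Error.
Variables (R : realType) (a : R) (xs d y : 'cV[R]_3) (Us : 'M[R]_(3, 2)) (Js : 'M[R[i]]_2).
Variables (N : nat) (ys : 'I_N -> 'cV[R]_3) (B : 'I_N -> R -> 'M[R[i]]_3) (Pi : mxfield R 3 3).
Hypothesis a_gt0 : 0 < a.
Hypothesis Us_basis : orthonormal_basis_perp d Us.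
Hypothesis Js_unit : Js \in unitmx.
Hypothesis G_cond : well_conditioned Us a xs.
Hypothesis y_off : x3 y != 0.
Hypothesis ys_off : forall n, x3 (ys n) != 0.
Hypothesis xs_y : y <> xs.
Hypothesis mirror_y : y <> mirror xs.
Hypothesis xs_ys : forall n, ys n <> xs.
Hypothesis mirror_ys : forall n, ys n <> mirror xs.
Hypothesis bounded_B : forall n, matrix_amp a (fun k _ => B n k).
Hypothesis PiE : forall x k, Pi x xs k = \sum_n Green x (ys n) k *m B n k.
Implicit Types (k : R) (u : R * R).

Local Notation UsC := (map_mx (real_complex R) Us).

Definition born_amp n k u : 'M[R[i]]_2 :=
  Upar ^t* *m (green_amp (array_point u) (ys n) k *m B n k) *m UsC.

Lemma tilde_Pi_cis k u : tilde Us Pi (array_point u) xs k =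
  \sum_n cis (k * array_dist (ys n) u) *: born_amp n k u.
Proof.
rewrite /tilde PiE mulmx_sumr mulmx_suml; apply: eq_bigr => n _.
by rewrite Green_cis -scalemxAl -scalemxAr -scalemxAl.
Qed.

Lemma matrix_amp_born_amp n : matrix_amp a (born_amp n).
Proof.
apply: matrix_ampM; last exact: matrix_amp_cst.
apply: matrix_ampM; first exact: matrix_amp_cst.
by apply: matrix_ampM; [exact: matrix_amp_green_array|exact: bounded_B].
Qed.

Lemma matrix_amp_tilde_amp : matrix_amp a (tilde_amp xs Us).
Proof.
apply: matrix_ampM; last exact: matrix_amp_cst.
apply: matrix_ampM; first exact: matrix_amp_cst.
apply: matrix_amp_green_array; exact: (source_off_plane a_gt0 Us_basis G_cond).
Qed.

(** Cramer's formula in place of [invmx], which branches on invertibility; the closure properties of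
    amplitudes apply to it directly. *)
Definition tilde_amp_inv k u : 'M[R[i]]_2 :=
  (\det ((tilde_amp xs Us k u) ^t*))^-1 *: \adj ((tilde_amp xs Us k u) ^t*).

Lemma det_adj n (A : 'M[R[i]]_n) : \det (A ^t*) = Num.conj (\det A).
Proof. by rewrite det_map_mx det_tr. Qed.

Lemma matrix_amp_tilde_amp_inv : matrix_amp a tilde_amp_inv.
Proof.
have h : matrix_amp a (fun k u => (tilde_amp xs Us k u) ^t*).
  by apply: matrix_amp_conj; apply: matrix_amp_tr; exact: matrix_amp_tilde_amp.
have [c [K [c0 hc]]] := tilde_amp_det_lower a_gt0 Us_basis G_cond.
apply: matrix_ampZ; last exact: matrix_amp_adj.
apply: (complex_ampV c0 (K := K)); last exact: complex_amp_det.
move=> k u Kk ua; apply: le_trans (hc k u Kk ua) _.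
by rewrite det_adj; case: (\det _) => x x' /=; rewrite sqrrN.
Qed.

Lemma invmx_tilde_Green : exists K, forall k u, K <= k -> array a u ->
  invmx ((tilde Us (@Green R) (array_point u) xs k) ^t*) =
  cis (k * array_dist xs u) *: tilde_amp_inv k u.
Proof.
have [c [K [c0 hc]]] := tilde_amp_det_lower a_gt0 Us_basis G_cond.
exists K => k u Kk ua; rewrite tilde_Green_cis adjZ conj_cis.
have du : (tilde_amp xs Us k u) ^t* \in unitmx.
  rewrite unitmxE unitfE det_adj conjC_eq0; apply/eqP => d0.
  have := hc k u Kk ua; rewrite d0 /= expr0n addr0 => /(lt_le_trans c0).
  by rewrite ltxx.
rewrite invmxZ; last by rewrite unitmxZ // unitfE cis_neq0.
by rewrite cisV opprK /tilde_amp_inv /invmx du.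
Qed.

Definition err_amp (A : 'M[R[i]]_2) m k u : 'M[R[i]]_3 :=
  mxconj (green_amp (array_point u) y k) *m
  (Upar *m (A *m Js *m (born_amp m k u) ^t* *m tilde_amp_inv k u *m invmx Js) *m UsC ^t*) *m
  mxconj (Green xs y k).

Lemma matrix_amp_err_amp (A : R -> R * R -> 'M[R[i]]_2) m :
  matrix_amp a A -> matrix_amp a (fun k u => err_amp (A k u) m k u).
Proof.
move=> hA; apply: matrix_ampM; last by apply: matrix_amp_conj; exact: matrix_amp_Green_cst.
apply: matrix_ampM; first by apply: matrix_amp_conj; exact: matrix_amp_green_array.
apply: matrix_ampM; last exact: matrix_amp_cst.
apply: matrix_ampM; first exact: matrix_amp_cst.
apply: matrix_ampM; last exact: matrix_amp_cst.
apply: matrix_ampM; last exact: matrix_amp_tilde_amp_inv.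
apply: matrix_ampM; last by apply: matrix_amp_conj; apply: matrix_amp_tr; exact: matrix_amp_born_amp.
by apply: matrix_ampM => //; exact: matrix_amp_cst.
Qed.

(* The two quadratic terms of the data, back-projected: interference of the
   direct wave, then of each scattered wave, with the conjugate scattered field. *)
Definition err k u : 'M[R[i]]_3 :=
  \sum_m cis (k * (2 * array_dist xs u + (-1) * array_dist (ys m) u + (-1) * array_dist y u +
                   0 * array_dist y u)) *: err_amp (tilde_amp xs Us k u) m k u +
  \sum_n \sum_m cis (k * (1 * array_dist xs u + 1 * array_dist (ys n) u + (-1) * array_dist (ys m) u +
                   (-1) * array_dist y u)) *: err_amp (born_amp n k u) m k u.

Lemma vanishing_integral_err i j : vanishing_integral a (fun k u => err k u i j).
Proof.
have x0 : x3 xs != 0 := source_off_plane a_gt0 Us_basis G_cond.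
have n2 : (2 : R) != 0 by rewrite pnatr_eq0.
apply: (@eq_vanishing_integral _ _ (fun k u =>
  \sum_m cis (k * (2 * array_dist xs u + (-1) * array_dist (ys m) u + (-1) * array_dist y u +
                   0 * array_dist y u)) * err_amp (tilde_amp xs Us k u) m k u i j +
  \sum_n \sum_m cis (k * (1 * array_dist xs u + 1 * array_dist (ys n) u + (-1) * array_dist (ys m) u +
                   (-1) * array_dist y u)) * err_amp (born_amp n k u) m k u i j)).
  move=> k u; rewrite /err mxE !summxE; congr (_ + _).
    by apply: eq_bigr => m _; rewrite [RHS]mxE.
  by apply: eq_bigr => n _; rewrite summxE; apply: eq_bigr => m _; rewrite [RHS]mxE.
apply: vanishing_integralD; apply: vanishing_integral_sum => m _.
  (* Only three distances occur in this phase; the fourth slot is filled by [y] with coefficient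
     0. *)
  apply: complex_amp_cis_vanishing_integral => //; exact: (matrix_amp_err_amp _ matrix_amp_tilde_amp).
apply: vanishing_integral_sum => n _.
apply: complex_amp_cis_vanishing_integral; rewrite ?oner_eq0 //; exact: (matrix_amp_err_amp _ (@matrix_amp_born_amp m)).
Qed.

Definition back_project k u (X : 'M[R[i]]_2) : 'M[R[i]]_3 :=
  mxconj (Green (array_point u) y k) *m
  (Upar *m (X *m Js *m (tilde Us Pi (array_point u) xs k) ^t* *m
     (cis (k * array_dist xs u) *: tilde_amp_inv k u) *m invmx Js) *m UsC ^t*) *m
  mxconj (Green xs y k).

Lemma back_projectD k u X Y : back_project k u (X + Y) = back_project k u X + back_project k u Y.
Proof. by rewrite /back_project !(mulmxDl, mulmxDr). Qed.

Lemma back_projectZ k u c A : back_project k u (c *: A) =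
  \sum_m (c * cis (k * (array_dist xs u - array_dist (ys m) u - array_dist y u))) *: err_amp A m k u.
Proof.
rewrite /back_project tilde_Pi_cis adj_sum mulmx_sumr !mulmx_suml mulmx_sumr !mulmx_suml mulmx_sumr.
rewrite mulmx_suml; apply: eq_bigr => m _.
rewrite adjZ conj_cis Green_cis mxconjZ conj_cis.
rewrite /err_amp; move: (tilde_amp_inv k u) (green_amp _ _ _) => T Gy.
rewrite -!(scalemxAl, scalemxAr) !scalerA; congr (_ *: _).
have -> : k * (array_dist xs u - array_dist (ys m) u - array_dist y u) =
  k * array_dist xs u + - (k * array_dist (ys m) u) + - (k * array_dist y u) by ring.
by rewrite !cisD; ring.
Qed.

(** The decomposition is exact; large [k] is required only for the inverse of the direct field to
    exist and to have the form of an amplitude times a phase. *)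
Lemma image_integrand : exists K, forall k u, K <= k -> array a u ->
  mxconj (Green (array_point u) y k) *m
    preprocess Us Js (coherency Us Js Pi) (array_point u) xs k *m mxconj (Green xs y k) =
  mxconj (Green (array_point u) y k) *m
    untilde Us (tilde Us Pi) (array_point u) xs k *m mxconj (Green xs y k) + err k u.
Proof.
have [K hK] := invmx_tilde_Green; have [C [K' hK']] := G_cond.
exists (Num.max K K') => k u; rewrite ge_max => /andP[Kk Kk'] ua.
have [Gu _] := hK' k u Kk' ua.
rewrite /preprocess /coherency /untilde.
set G := tilde Us (@Green R) _ _ _ in Gu *; set P := tilde Us Pi _ _ _.
have Gu' : G ^t* \in unitmx by rewrite unitmxE unitfE det_adj conjC_eq0 -unitfE -unitmxE.
rewrite (data_split G P (P ^t*) Gu' Js_unit).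
have hG := hK k u Kk ua; rewrite -/G in hG; rewrite hG.
transitivity (mxconj (Green (array_point u) y k) *m (Upar *m P *m UsC ^t*) *m
    mxconj (Green xs y k) + back_project k u (G + P)).
  by rewrite /back_project -/P; move: (_ *m invmx Js) => X; rewrite mulmxDr !mulmxDl mulmxDr mulmxDl.
congr (_ + _).
rewrite back_projectD /err.
rewrite /G /P tilde_Green_cis tilde_Pi_cis back_projectZ; congr (_ + _).
  by apply: eq_bigr => m _; rewrite -cisD; congr (cis _ *: _); ring.
have -> : back_project k u (\sum_n cis (k * array_dist (ys n) u) *: born_amp n k u) =
    \sum_n back_project k u (cis (k * array_dist (ys n) u) *: born_amp n k u).
  apply: (big_morph (back_project k u)) => [X Y|]; first exact: back_projectD.
  by rewrite -[0](scale0r 0) back_projectZ big1 // => m _; rewrite mul0r scale0r.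
apply: eq_bigr => n _; rewrite back_projectZ; apply: eq_bigr => m _.
by rewrite -cisD; congr (cis _ *: _); ring.
Qed.

Lemma eventually_integrable_image i j : eventually_integrable a (fun k u =>
  (mxconj (Green (array_point u) y k) *m
    untilde Us (tilde Us Pi) (array_point u) xs k *m mxconj (Green xs y k)) i j).
Proof.
pose A n k u := mxconj (green_amp (array_point u) y k) *m
  (Upar *m born_amp n k u *m UsC ^t*) *m mxconj (Green xs y k).
have hA n : matrix_amp a (A n).
  apply: matrix_ampM; last by apply: matrix_amp_conj; exact: matrix_amp_Green_cst.
  apply: matrix_ampM; first by apply: matrix_amp_conj; exact: matrix_amp_green_array.
  apply: matrix_ampM; last exact: matrix_amp_cst.
  by apply: matrix_ampM; [exact: matrix_amp_cst|exact: matrix_amp_born_amp].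
apply: (@eq_eventually_integrable _ _ 0 (fun k u => \sum_n cis (k * (array_dist (ys n) u - array_dist y u)) * A n k u i j)).
  move=> k u _ _; rewrite /untilde tilde_Pi_cis.
  rewrite mulmx_sumr !mulmx_suml mulmx_sumr mulmx_suml summxE; apply: eq_bigr => n _.
  rewrite Green_cis mxconjZ conj_cis -!(scalemxAl, scalemxAr) scalerA [RHS]mxE -cisD.
  by congr (cis _ * _); rewrite -/(array_dist y u); ring.
apply: eventually_integrable_sum => n _; apply: complex_amp_cis_eventually_integrable; last exact: hA.
by apply: measurable_funB; exact: measurable_array_dist.
Qed.

Lemma kirchhoff_preprocess_asymp :
  asymp_eq (kirchhoff a xs (preprocess Us Js (coherency Us Js Pi)) y)
           (kirchhoff a xs (untilde Us (tilde Us Pi)) y).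
Proof.
apply: asymp_eq_entries => i j.
have [[K1 i1] [r1 r2]] := vanishing_integral_err i j; have [K2 i2] := eventually_integrable_image i j.
have [K3 e3] := image_integrand.
have ev : \forall k \near +oo, cintegral (array a) (fun u => err k u i j) =
   (kirchhoff a xs (preprocess Us Js (coherency Us Js Pi)) y k -
    kirchhoff a xs (untilde Us (tilde Us Pi)) y k) i j.
  near=> k.
  have k1 : K1 <= k by near: k; apply: nbhs_pinfty_ge; exact: num_real.
  have k2 : K2 <= k by near: k; apply: nbhs_pinfty_ge; exact: num_real.
  have k3 : K3 <= k by near: k; apply: nbhs_pinfty_ge; exact: num_real.
  rewrite /kirchhoff /mxintegral !mxE.
  have e : cintegral (array a) (fun u => (mxconj (Green (array_point u) y k) *m
      preprocess Us Js (coherency Us Js Pi) (array_point u) xs k *m mxconj (Green xs y k)) i j) =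
    cintegral (array a) (fun u => (mxconj (Green (array_point u) y k) *m
      untilde Us (tilde Us Pi) (array_point u) xs k *m mxconj (Green xs y k)) i j) +
    cintegral (array a) (fun u => err k u i j).
    rewrite -cintegralD; [|exact: i2|exact: i1].
    apply: eq_cintegral => u ua.
    exact: etrans (congr1 (fun M : 'M[R[i]]_3 => M i j) (e3 k u k3 ua)) (mx_entryD _ _ i j).
  exact: addIr_subr e.
split.
- by apply: near_cvg0D r1 (cvg_cst 0); apply: filterS ev => k <-; rewrite addr0.
- by apply: near_cvg0D r2 (cvg_cst 0); apply: filterS ev => k <-; rewrite addr0.
Unshelve. all: by end_near.
Qed.

End Error.

(** * Position of the source relative to the window *)

Section Geometry.
Variable R : realType.

Lemma kirchhoff_at_source (a : R) (xs : 'cV[R]_3) (M : mxfield R 3 3) k : kirchhoff a xs M xs k = 0.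
Proof.
have z : Green xs xs k = 0.
  rewrite /Green /Green0 subrr (_ : enorm 0 = 0).
    by rewrite !mulr0 rmorph0 invr0 mulr0 scale0r.
  by rewrite /enorm big1 ?sqrtr0 // => i _; rewrite mxE expr0n.
apply/matrixP => i j; rewrite !mxE (eq_cintegral (g := fun=> 0)).
  by rewrite /cintegral /= Rintegral_cst ?mul0r //; exact: measurable_array.
by move=> u _; rewrite z /mxconj map_mx0 mulmx0 mxE.
Qed.

Lemma window_off_plane (b h L : R) (y : 'cV[R]_3) : h < 2 * L -> window b h L y -> x3 y != 0.
Proof. by move=> hL [_ /andP[y3 _]]; rewrite gt_eqF //; apply: lt_le_trans y3; lra. Qed.

(* Seen from the centre of the array, such a point makes an angle of sine at most
   [sqrt 2 * kappa] with the vertical. *)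
Lemma window_in_region3 (a b h L : R) (x : 'cV[R]_3) : 0 < a -> 0 < b -> h < 2 * L ->
  (forall i, - (b / 2) <= par x i 0 <= b / 2) -> L - h / 2 <= `|x3 x| -> region a b h L 3 x.
Proof.
move=> a0 b0 hL xpar x3x; exists (0, 0); first by apply/arrayP => /=; split; lra.
have e0 : array_point (0, 0) = 0 :> 'cV[R]_3.
  by apply/matrixP => i j; rewrite !mxE; case: i => [[|[|[|//]]]] hi.
rewrite /= e0 /par mulmx0 !sub0r.
have q0 := xpar 0; have q1 := xpar 1; rewrite /par !Upar_tr_mul plane_index0 plane_index1 in q0 q1.
set X := a + b; set Z := 2 * L - h.
have Z0 : 0 < Z by rewrite /Z; lra.
have X0 : 0 < X by rewrite /X; lra.
have D0 : 0 < Z ^+ 2 + X ^+ 2 by rewrite addr_gt0 ?exprn_gt0.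
have E0 : 0 <= \sum_i (- x) i 0 ^+ 2 by apply: sumr_ge0 => i _; exact: sqr_ge0.
rewrite /enorm /kappa -/X -/Z.
have k0 : 0 <= X / Num.sqrt (Z ^+ 2 + X ^+ 2) * 3 by rewrite !mulr_ge0 ?invr_ge0 ?sqrtr_ge0 // ltW.
rewrite -[X / _ * 3](ger0_norm k0) -sqrtr_sqr -sqrtrM ?sqr_ge0 //; apply: ler_wsqrtr.
rewrite exprMn exprMn exprVn sqr_sqrtr ?(ltW D0) // sum_ord2 sum_ord3.
have oppE n (M : 'cV[R]_n) i : (- M) i 0 = - M i 0 by rewrite mxE.
rewrite !oppE !Upar_tr_mul plane_index0 plane_index1 -/(x3 x).
have -> : X ^+ 2 / (Z ^+ 2 + X ^+ 2) * 3 ^+ 2 * ((- x 0 0) ^+ 2 + (- x 1 0) ^+ 2 + (- x3 x) ^+ 2) =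
  (9 * X ^+ 2 * (x 0 0 ^+ 2 + x 1 0 ^+ 2 + x3 x ^+ 2)) / (Z ^+ 2 + X ^+ 2).
  by field; rewrite gt_eqF.
rewrite ler_pdivlMr // !sqrrN.
have s3 : Z ^+ 2 <= 4 * x3 x ^+ 2.
  rewrite -[x3 x ^+ 2]real_normK ?num_real //.
  have : Z <= 2 * `|x3 x| by rewrite /Z; lra.
  by move=> h1; have := ler_pM (ltW Z0) (ltW Z0) h1 h1; rewrite -!expr2; lra.
have s0 : 4 * x 0 0 ^+ 2 <= X ^+ 2 by rewrite /X; nra.
have s1 : 4 * x 1 0 ^+ 2 <= X ^+ 2 by rewrite /X; nra.
set A := x 0 0 ^+ 2 in s0 *; set B := x 1 0 ^+ 2 in s1 *; set C := x3 x ^+ 2 in s3 *.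
have A0 : 0 <= A by exact: sqr_ge0.
have B0 : 0 <= B by exact: sqr_ge0.
have XX : 0 <= X ^+ 2 by exact: sqr_ge0.
have ZZ : 0 <= Z ^+ 2 by exact: sqr_ge0.
(* This absorbs the vertical part into [9 X^2 C], while [(A + B) X^2] is absorbed by the horizontal
   part of the right side. *)
have h1 : (A + B) * Z ^+ 2 <= X ^+ 2 * (4 * C) by apply: ler_pM => //; lra.
nra.
Qed.

(** Either coincidence would put [xs] over the horizontal square of the window at height at least
    [L - h / 2] in absolute value, hence in the region. Reflection changes only the sign of the
    height. *)
Lemma window_avoids_source (a b h L : R) (xs y : 'cV[R]_3) : 0 < a -> 0 < b -> h < 2 * L ->
  ~ region a b h L 3 xs -> window b h L y -> y <> xs /\ y <> mirror xs.
Proof.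
move=> a0 b0 hL nreg [ypar /andP[y3 _]]; split=> e; apply: nreg; apply: window_in_region3 => //.
- by rewrite -e.
- by rewrite -e; apply: le_trans y3 (ler_norm _).
- move=> i; have := ypar i; rewrite e /par !Upar_tr_mul mxE ifF //.
  by apply/negbTE; move: i; apply: ord2_cases.
- by move: y3; rewrite e /x3 mxE eqxx -normrN => h'; apply: le_trans h' (ler_norm _).
Qed.

End Geometry.

End Aux.

Theorem theorem1 (R : realType) (a b h L : R)
    (a_gt0 : 0 < a) (b_gt0 : 0 < b) (h_gt0 : 0 < h) (L_gt0 : 0 < L)
    (h_lt : h < 2 * L)
    (N : nat) (ys : 'I_N -> 'cV[R]_3) (ys_inj : injective ys)
    (ys_window : forall n, window b h L (ys n))
    (alpha : 'I_N -> 'M[R[i]]_3) (alpha_sym : forall n, (alpha n)^T = alpha n)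
    (xs y0 : 'cV[R]_3) (xs_ys : forall n, xs <> ys n)
    (Us : 'M[R]_(3, 2)) (Us_basis : orthonormal_basis_perp (y0 - xs) Us)
    (Js : 'M[R[i]]_2) (Js_herm : Js \is hermsymmx) (Js_unit : Js \in unitmx)
    (G_cond : well_conditioned Us a xs) :
  (~ region a b h L 1 xs ->
   (forall n, ys n <> mirror xs) ->
   forall Pi : mxfield R 3 3, Pi = born_term ys alpha 1 ->
   forall y, window b h L y -> y <> mirror xs ->
   asymp_eq (kirchhoff a xs (preprocess Us Js (coherency Us Js Pi)) y)
            (kirchhoff a xs (untilde Us (tilde Us Pi)) y))
  /\
  (~ region a b h L 3 xs ->
   forall (J : nat) (Pi : mxfield R 3 3), Pi = born_sum ys alpha J ->
   forall y, window b h L y ->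
   asymp_eq (kirchhoff a xs (preprocess Us Js (coherency Us Js Pi)) y)
            (kirchhoff a xs (untilde Us (tilde Us Pi)) y)).
Proof.
have off n : x3 (ys n) != 0 by apply: Aux.window_off_plane (ys_window n).
have nxs n : ys n <> xs by move=> e; exact: (xs_ys n (esym e)).
split=> [_ ys_mirror Pi -> y yW y_mirror|nreg J Pi -> y yW].
  have yoff := Aux.window_off_plane h_lt yW.
  have [B [hB PiE]] := @Aux.last_scattering_born_term _ a _ ys alpha xs 1 isT.
  (* At [y = xs] the factor [Green xs y k] is 0, so both images vanish identically. *)
  have [->|/eqP y_xs] := eqVneq y xs.
    apply: Aux.asymp_eq_entries => i j.
    have z k : kirchhoff a xs (preprocess Us Js (coherency Us Js (born_term ys alpha 1))) xs k -
        kirchhoff a xs (untilde Us (tilde Us (born_term ys alpha 1))) xs k = 0.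
      by rewrite !Aux.kirchhoff_at_source subrr.
    by split; under eq_fun do rewrite z mxE; exact: cvg_cst.
  exact: (Aux.kirchhoff_preprocess_asymp a_gt0 Us_basis Js_unit G_cond yoff off y_xs
    y_mirror nxs ys_mirror hB PiE).
have yoff := Aux.window_off_plane h_lt yW.
have [B [hB PiE]] := @Aux.last_scattering_born_sum _ a _ ys alpha xs J.
have [y_xs y_mirror] := Aux.window_avoids_source a_gt0 b_gt0 h_lt nreg yW.
have ys_mirror n := (Aux.window_avoids_source a_gt0 b_gt0 h_lt nreg (ys_window n)).2.
exact: (Aux.kirchhoff_preprocess_asymp a_gt0 Us_basis Js_unit G_cond yoff off y_xs
  y_mirror nxs ys_mirror hB PiE).
Qed.
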